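(* Let $\mathcal{A}$ be a unital $JB$-algebra and let $A,B\in\mathcal{A}$ be positive invertible elements. For $\nu\in\mathbb{R}$ put $\alpha(\nu)=(1-2\nu)^2$. Then $$H_\nu(A,B)\le F_{\alpha(\nu)}(A,B)\quad\text{for all }\nu\in[0,1],$$ $$H_\nu(A,B)\ge F_{\alpha(\nu)}(A,B)\quad\text{for all real }\nu\notin(0,1).$$
   Context: A Jordan algebra over $\mathbb{R}$ is a real vector space $\mathcal{A}$ with a commutative bilinear product $\circ$ satisfying $a\circ(b\circ a^2)=(a\circ b)\circ a^2$. A $JB$-algebra is a real Jordan algebra with a complete norm satisfying $\|A\circ B\|\le\|A\|\|B\|$, $\|A^2\|=\|A\|^2$ and $\|A^2\|\le\|A^2+B^2\|$ for all $A,B$; it is unital if it has a unit $I$. An element $A$ is invertible if there is $A^{-1}\in\mathcal{A}$ with $A\circ A^{-1}=I$ and $A^2\circ A^{-1}=A$. The spectrum $Sp(A)$ is the set of $\lambda\in\mathbb{R}$ such that $A-\lambda I$ is not invertible; $A\ge0$ (positive) means $Sp(A)\subset[0,\infty)$, and $A\le B$ means $B-A\ge0$. The triple product is $\{ABA\}=U_A(B):=2(A\circ B)\circ A-A^2\circ B$. Real powers of a positive invertible element are defined by continuous functional calculus. For positive invertible $A,B\in\mathcal{A}$ and real $\nu$: $A\sharp_\nu B:=\{A^{1/2}\{A^{-1/2}BA^{-1/2}\}^{\nu}A^{1/2}\}$, $A\sharp B:=A\sharp_{1/2}B$, $A\nabla B:=\frac{A+B}{2}$; the Heinz mean is $H_\nu(A,B):=\frac{A\sharp_\nu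 B+A\sharp_{1-\nu}B}{2}$ and the Heron mean is $F_\nu(A,B):=(1-\nu)(A\sharp B)+\nu(A\nabla B)$. *)

(* Defs.v *)
From HB Require Import structures.
From mathcomp Require Import all_boot all_order all_algebra.
From mathcomp Require Import all_classical all_reals all_analysis.

Set Implicit Arguments.
Unset Strict Implicit.
Unset Printing Implicit Defensive.

Import Order.TTheory GRing.Theory Num.Theory numFieldNormedType.Exports.

Local Open Scope classical_set_scope.
Local Open Scope ring_scope.

(* Linearity in the second argument follows from commutativity. *)
HB.mixin Record Lmodule_isJordan (R : realType) V of GRing.Lmodule R V := {
  jmul : V -> V -> V ;
  jmulC : forall a b, jmul a b = jmul b a ;
  jmulDl : forall a b c, jmul (a + b) c = jmul a c + jmul b c ;
  jmulZl : forall (k : R) a b, jmul (k *: a) b = k *: jmul a b ;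
  jordan_identity : forall a b,
    jmul a (jmul b (jmul a a)) = jmul (jmul a b) (jmul a a)
}.

#[short(type="jordanAlgType")]
HB.structure Definition JordanAlgebra (R : realType) :=
  {V of Lmodule_isJordan R V & GRing.Lmodule R V}.

Reserved Notation "a ∘ b" (at level 40, left associativity).
Notation "a ∘ b" := (jmul a b) : ring_scope.

HB.mixin Record Jordan_isJB (R : realType) V
    of JordanAlgebra R V & CompleteNormedModule R V := {
  jb_normM : forall a b : V, `|a ∘ b| <= `|a| * `|b| ;
  jb_norm_sqr : forall a : V, `|a ∘ a| = `|a| ^+ 2 ;
  jb_norm_sqrD : forall a b : V, `|a ∘ a| <= `|a ∘ a + b ∘ b|
}.

#[short(type="jbAlgType")]
HB.structure Definition JBAlgebra (R : realType) :=
  {V of Jordan_isJB R V & JordanAlgebra R V & CompleteNormedModule R V}.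

(* The unit is not required to be nonzero. *)
HB.mixin Record JB_isUnital (R : realType) V of JBAlgebra R V := {
  jone : V ;
  jmul1 : forall a : V, jone ∘ a = a
}.

#[short(type="unitalJBAlgType")]
HB.structure Definition UnitalJBAlgebra (R : realType) :=
  {V of JB_isUnital R V & JBAlgebra R V}.

Section UnitalJB.
Context {R : realType} {V : unitalJBAlgType R}.
Implicit Types (a b : V) (nu : R).

Definition jinvertible a : Prop :=
  exists x : V, a ∘ x = jone /\ (a ∘ a) ∘ x = a.

Definition Sp a : set R := [set l | ~ jinvertible (a - l *: jone)].

Definition jpositive a : Prop := Sp a `<=` [set l | 0 <= l].

Definition jle a b : Prop := jpositive (b - a).

(* {aba} *)
Definition jU a b : V := 2 *: ((a ∘ b) ∘ a) - (a ∘ a) ∘ b.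

(* phi is the isometric unital homomorphism C(Sp a) -> V sending the identity
   function to a. An element of C(Sp a) is represented by any function R -> R
   that is continuous on Sp a; by the isometry clause (with additivity) the
   value of phi depends only on the restriction of the function to Sp a. By
   density of the polynomials there is at most one such homomorphism. *)
Record continuous_functional_calculus a (phi : (R -> R) -> V) : Prop := {
  cfcD : forall f g : R -> R,
    {within Sp a, continuous f} -> {within Sp a, continuous g} ->
    phi (fun x => f x + g x) = phi f + phi g ;
  cfcZ : forall (k : R) (f : R -> R), {within Sp a, continuous f} ->
    phi (fun x => k * f x) = k *: phi f ;
  cfcM : forall f g : R -> R,
    {within Sp a, continuous f} -> {within Sp a, continuous g} ->
    phi (fun x => f x * g x) = phi f ∘ phi g ;
  cfc1 : phi (fun=> 1) = jone ;
  cfc_id : phi (fun x => x) = a ;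
  cfc_norm : forall f : R -> R, {within Sp a, continuous f} ->
    `|phi f| = sup [set `|f x| | x in Sp a]
}.

(* f(a), meaningful for f continuous on Sp a *)
Definition cfc a (f : R -> R) : V :=
  get [set x : V | exists2 phi, continuous_functional_calculus a phi
                              & phi f = x].

(* meaningful for a positive and invertible, i.e. Sp a contained in ]0, +oo[ *)
Definition jpow a nu : V := cfc a (fun x => x `^ nu).

Definition sharp nu a b : V :=
  jU (jpow a 2^-1) (jpow (jU (jpow a (- 2^-1)) b) nu).

Definition nabla a b : V := 2^-1 *: (a + b).

Definition heinz nu a b : V := 2^-1 *: (sharp nu a b + sharp (1 - nu) a b).

Definition heron nu a b : V :=
  (1 - nu) *: sharp 2^-1 a b + nu *: nabla a b.

End UnitalJB.

(* Main.v *)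
(* Each element of the algebra generates a closed subalgebra in which all
   multiplication operators commute. There the norm axioms give square roots of
   1 - z for ‖z‖ < 1, the cone of squares, and hence a polynomial functional
   calculus that is isometric on the (Jordan) spectrum; the Weierstrass theorem
   extends it to continuous functions.

   The quadratic operators satisfy U_p U_q = U_pq for p, q in such a
   subalgebra, so with C = U_{A^(-1/2)} B one has A = U_{A^(1/2)} 1,
   B = U_{A^(1/2)} C, and the difference of the Heron and Heinz means equals
   U_{A^(1/2)} g(C) with g(x) the scalar difference for the pair (1, x). With
   x = exp(4t) and b = 1 - 2 nu, g(x) is a positive multiple of
   b^2 sinh(t)^2 - sinh(b t)^2, whose sign depends only on whether |b| <= 1.

   It remains to see that U_a preserves positivity for a = A^r. For 0 <= b <= 1
   one has b >= b^2, so b + 2 h b + h^2 >= (b + h)^2 >= 0: thus U_{1+h} is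
   positive up to an error of order ‖h‖^2. Applied to 1 + h = a^(1/n), where h
   has size 1/n, the n-fold iterate U_a = U_{1+h}^n is positive up to an error
   of order 1/n. *)

From HB Require Import structures.
Require Import Defs.
From mathcomp Require Import all_boot all_order all_algebra.
From mathcomp Require complex.
From mathcomp Require Import all_classical all_reals all_analysis.
From mathcomp Require Import ring lra.

Set Implicit Arguments.
Unset Strict Implicit.
Unset Printing Implicit Defensive.

Import Order.TTheory GRing.Theory Num.Theory numFieldNormedType.Exports.
Local Open Scope classical_set_scope.
Local Open Scope ring_scope.

(** * Linear arithmetic in modules and the linearised Jordan identity *)

Section LinearExpressions.
Context {R : comNzRingType} {V : lmodType R}.

Inductive lexp :=
  LVar of nat | LZero | LAdd of lexp & lexp | LOpp of lexp
| LScale of R & lexp | LMuln of lexp & nat.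

Fixpoint leval (env : seq V) e : V :=
  match e with
  | LVar i => env`_i
  | LZero => 0
  | LAdd e1 e2 => leval env e1 + leval env e2
  | LOpp e => - leval env e
  | LScale k e => k *: leval env e
  | LMuln e n => leval env e *+ n
  end.

(** [Nat.eqb] reduces on closed indices, so that after computation [lmod] is left with identities
    between scalars only. *)
Fixpoint lcoef i e : R :=
  match e with
  | LVar j => if Nat.eqb i j then 1 else 0
  | LZero => 0
  | LAdd e1 e2 => lcoef i e1 + lcoef i e2
  | LOpp e => - lcoef i e
  | LScale k e => k * lcoef i e
  | LMuln e n => lcoef i e *+ n
  end.

Fixpoint lcoefs_eq n e1 e2 : Prop :=
  if n is n.+1 then lcoef n e1 = lcoef n e2 /\ lcoefs_eq n e1 e2 else True.

Lemma leval_coef env e :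
  leval env e = \sum_(i < size env) lcoef i e *: env`_i.
Proof.
elim: e => [j||e1 IH1 e2 IH2|e IH|k e IH|e IH n] /=.
- case: (ltnP j (size env)) => [jlt|jge].
    rewrite (bigD1 (Ordinal jlt)) //= PeanoNat.Nat.eqb_refl scale1r.
    rewrite big1 ?addr0 // => i; rewrite -val_eqE /= => nij.
    case: PeanoNat.Nat.eqb_spec => [ij|_]; last by rewrite scale0r.
    by rewrite ij eqxx in nij.
  rewrite nth_default // big1 // => i _.
  case: PeanoNat.Nat.eqb_spec => [ij|_]; last by rewrite scale0r.
  by rewrite -ij leqNgt ltn_ord in jge.
- by rewrite big1 // => i _; rewrite scale0r.
- by rewrite IH1 IH2 -big_split /=; apply: eq_bigr => i _; rewrite scalerDl.
- by rewrite IH -sumrN; apply: eq_bigr => i _; rewrite scaleNr.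
- by rewrite IH scaler_sumr; apply: eq_bigr => i _; rewrite scalerA.
- by rewrite IH -sumrMnl; apply: eq_bigr => i _; rewrite scalerMnl.
Qed.

Lemma leval_eq env e1 e2 :
  lcoefs_eq (size env) e1 e2 -> leval env e1 = leval env e2.
Proof.
move=> H; rewrite !leval_coef; apply: eq_bigr => -[i ilt] _ /=; congr (_ *: _).
elim: (size env) ilt H => //= n IH; rewrite ltnS leq_eqVlt.
by case/orP => [/eqP-> []//|ilt [_]]; apply: IH.
Qed.

(** This lemma and the next two derive an equation from known ones by naming the coefficients; the
    side condition is then a case for [lmod]. *)
Lemma eq_lincomb1 k (l r u v : V) : l = r -> u - v = k *: (l - r) -> u = v.
Proof. by move=> ->; rewrite subrr scaler0 => /subr0_eq. Qed.

Lemma eq_lincomb2 k k' (l r l' r' u v : V) : l = r -> l' = r' ->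
  u - v = k *: (l - r) + k' *: (l' - r') -> u = v.
Proof. by move=> -> ->; rewrite !subrr !scaler0 addr0 => /subr0_eq. Qed.

Lemma eq_lincomb3 k k' k'' (l r l' r' l'' r'' u v : V) :
  l = r -> l' = r' -> l'' = r'' ->
  u - v = k *: (l - r) + k' *: (l' - r') + k'' *: (l'' - r'') -> u = v.
Proof. by move=> -> -> ->; rewrite !subrr !scaler0 !addr0 => /subr0_eq. Qed.

End LinearExpressions.

Ltac lindex x env :=
  match env with
  | x :: _ => constr:(0%N)
  | _ :: ?t => let n := lindex x t in constr:(n.+1)
  end.
Ltac ladd x env :=
  match env with
  | context [x :: _] => env
  | _ => constr:(x :: env)
  end.
Ltac lenv env u :=
  lazymatch u with
  | GRing.add ?a ?b => let env := lenv env a in lenv env b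
  | GRing.opp ?a => lenv env a
  | GRing.scale ?k ?a => lenv env a
  | GRing.natmul ?a _ => lenv env a
  | GRing.zero => env
  | _ => ladd u env
  end.
Ltac lreify R env u :=
  lazymatch u with
  | GRing.add ?a ?b =>
      let x := lreify R env a in let y := lreify R env b in constr:(@LAdd R x y)
  | GRing.opp ?a => let x := lreify R env a in constr:(@LOpp R x)
  | GRing.scale ?k ?a => let x := lreify R env a in constr:(@LScale R k x)
  | GRing.natmul ?a ?n => let x := lreify R env a in constr:(@LMuln R x n)
  | GRing.zero => constr:(@LZero R)
  | _ => let n := lindex u env in constr:(@LVar R n)
  end.
(* Decides equalities between linear combinations in a module over R,
   by comparing the coefficients of each atom with [ring]. *)
Ltac lmod R :=
  lazymatch goal with
  | |- @eq ?T ?u ?v =>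
      let e0 := constr:(@nil T) in
      let env := lenv e0 u in let env := lenv env v in
      let x := lreify R env u in let y := lreify R env v in
      refine (@leval_eq R _ env x y _); cbn [lcoefs_eq size lcoef Nat.eqb];
      repeat (split; [first [ring | field]|]); done
  end.

(** * Polarisation of the Jordan identity *)

Section JordanIdentities.
Context {R : realType} {V : jordanAlgType R}.
Implicit Types (a b c d u v x y z : V) (k : R).

Lemma jmulDr a b c : a ∘ (b + c) = a ∘ b + a ∘ c.
Proof. by rewrite jmulC jmulDl !(jmulC a). Qed.
Lemma jmulZr k a b : a ∘ (k *: b) = k *: (a ∘ b).
Proof. by rewrite jmulC jmulZl (jmulC a). Qed.
Lemma jmulNl a b : (- a) ∘ b = - (a ∘ b).
Proof. by rewrite -scaleN1r jmulZl scaleN1r. Qed.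
Lemma jmulNr a b : a ∘ (- b) = - (a ∘ b).
Proof. by rewrite jmulC jmulNl jmulC. Qed.
Lemma jmul0l a : 0 ∘ a = 0.
Proof. by rewrite -{1}(scale0r a) jmulZl scale0r. Qed.
Lemma jmul0r a : a ∘ 0 = 0.
Proof. by rewrite jmulC jmul0l. Qed.
Lemma jmulBl a b c : (a - b) ∘ c = a ∘ c - b ∘ c.
Proof. by rewrite jmulDl jmulNl. Qed.
Lemma jmulBr a b c : a ∘ (b - c) = a ∘ b - a ∘ c.
Proof. by rewrite jmulDr jmulNr. Qed.
Definition jmulE :=
  (@jmulDl R V, jmulDr, jmulNl, jmulNr, @jmulZl R V, jmulZr, jmul0l, jmul0r).

(** The commutator [L_x, L_yz] applied to [v], where L denotes multiplication. *)
Definition jdefect v x y z := x ∘ (v ∘ (y ∘ z)) - (x ∘ v) ∘ (y ∘ z).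

Lemma jdefect_diag v x : jdefect v x x x = 0.
Proof. by rewrite /jdefect jordan_identity subrr. Qed.

Lemma jdefectC v x y z : jdefect v x y z = jdefect v x z y.
Proof. by rewrite /jdefect (jmulC y). Qed.


Lemma jdefectDx v x x' y z :
  jdefect v (x + x') y z = jdefect v x y z + jdefect v x' y z.
Proof. by rewrite /jdefect !jmulE; lmod R. Qed.

Lemma jdefectNx v x y z : jdefect v (- x) y z = - jdefect v x y z.
Proof. by rewrite /jdefect !jmulE; lmod R. Qed.

Lemma jdefectDy v x y y' z :
  jdefect v x (y + y') z = jdefect v x y z + jdefect v x y' z.
Proof. by rewrite /jdefect !jmulE; lmod R. Qed.

Lemma jdefectNy v x y z : jdefect v x (- y) z = - jdefect v x y z.
Proof. by rewrite /jdefect !jmulE; lmod R. Qed.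

Lemma jdefectDz v x y z z' :
  jdefect v x y (z + z') = jdefect v x y z + jdefect v x y z'.
Proof. by rewrite /jdefect !jmulE; lmod R. Qed.

Lemma jdefectNz v x y z : jdefect v x y (- z) = - jdefect v x y z.
Proof. by rewrite /jdefect !jmulE; lmod R. Qed.

Let jdefectE := (jdefectDx, jdefectDy, jdefectDz, jdefectNx, jdefectNy, jdefectNz).

(** On the diagonal the defect is a cubic form f, and its part linear in [c] is (f(a + c) - f(a -
    c)) / 2 - f(c). *)
Lemma jdefect_polar1 v a c : 2 *: jdefect v a a c + jdefect v c a a = 0.
Proof.
have H1 := jdefect_diag v (a + c); have H2 := jdefect_diag v (a - c).
have H3 := jdefect_diag v c.
rewrite !jdefectE !(jdefectC _ _ c a) in H1 H2.
by apply: (eq_lincomb3 (k := 2^-1) (k' := - 2^-1) (k'' := -1) H1 H2 H3); lmod R.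
Qed.

(* The polarised form of the Jordan identity:
   [L_a, L_bc] + [L_b, L_ac] + [L_c, L_ab] = 0. *)
Lemma jdefect_polar v a b c :
  jdefect v a b c + jdefect v b a c + jdefect v c a b = 0.
Proof.
have H1 := jdefect_polar1 v (a + b) c; have H2 := jdefect_polar1 v a c.
have H3 := jdefect_polar1 v b c.
rewrite !jdefectE (jdefectC _ _ b a) in H1.
by apply: (eq_lincomb3 (k := 2^-1) (k' := - 2^-1) (k'' := - 2^-1) H1 H2 H3);
  lmod R.
Qed.

Lemma jmul_op_mul3 a b c v :
  (a ∘ (b ∘ c)) ∘ v = a ∘ ((b ∘ c) ∘ v) + b ∘ ((c ∘ a) ∘ v) + c ∘ ((a ∘ b) ∘ v)
                      - b ∘ (a ∘ (c ∘ v)) - c ∘ (a ∘ (b ∘ v)).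
Proof.
(* [\sum (a ∘ v) ∘ (b ∘ c)] over the three pairings of a, b, c, v is symmetric
   in all four, hence so is the other half of the polarised identity. *)
have H1 := jdefect_polar v a b c; have H2 := jdefect_polar a v b c.
rewrite /jdefect in H1 H2; apply: (eq_lincomb2 (k := 1) (k' := -1) H2 H1).
rewrite !(jmulC _ v) !(jmulC c a) !(jmulC _ a) (jmulC (a ∘ b)).
by rewrite (jmulC (a ∘ c)); lmod R.
Qed.

Definition jcommute x y := forall v, x ∘ (y ∘ v) = y ∘ (x ∘ v).

Lemma jcommute_sqr a : jcommute a (a ∘ a).
Proof. by move=> v; rewrite (jmulC _ v) jordan_identity jmulC. Qed.

End JordanIdentities.

(** * Power associativity *)

Section AssociativeSubalgebra.
Context {R : realType} {V : unitalJBAlgType R}.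
Implicit Types (a b c x y z v w : V) (C : set V).

(** The multiplications commute as operators on the whole algebra, not just on [C]. This is what
    [jU_mul] needs, and it yields associativity with an arbitrary middle factor. *)
Record assoc_subalg C : Prop := {
  asub1 : C jone ;
  asubD : forall x y, C x -> C y -> C (x + y) ;
  asubZ : forall (k : R) x, C x -> C (k *: x) ;
  asubM : forall x y, C x -> C y -> C (x ∘ y) ;
  asubC : forall x y, C x -> C y -> jcommute x y
}.

Lemma asubN C x : assoc_subalg C -> C x -> C (- x).
Proof. by move=> hC Cx; rewrite -scaleN1r; exact: asubZ. Qed.

Lemma asubB C x y : assoc_subalg C -> C x -> C y -> C (x - y).
Proof. by move=> hC Cx Cy; apply: asubD => //; exact: asubN. Qed.

Lemma asubA C x y z : assoc_subalg C -> C x -> C z ->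
  x ∘ (y ∘ z) = (x ∘ y) ∘ z.
Proof. by move=> hC Cx Cz; rewrite (jmulC y) (asubC hC) // jmulC. Qed.

Lemma jmulr1 x : x ∘ jone = x.
Proof. by rewrite jmulC jmul1. Qed.

Lemma jUE a b : jU a b = 2 *: (a ∘ (a ∘ b)) - (a ∘ a) ∘ b.
Proof. by rewrite /jU (jmulC (a ∘ b)). Qed.

Lemma jUDl a b c : jU a (b + c) = jU a b + jU a c.
Proof. by rewrite !jUE !jmulDr; lmod R. Qed.

Lemma jUZ a (k : R) b : jU a (k *: b) = k *: jU a b.
Proof. by rewrite !jUE !jmulZr; lmod R. Qed.

Lemma jUN a b : jU a (- b) = - jU a b.
Proof. by rewrite -scaleN1r jUZ scaleN1r. Qed.

Lemma jUB a b c : jU a (b - c) = jU a b - jU a c.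
Proof. by rewrite jUDl jUN. Qed.

Lemma jU1l b : jU jone b = b.
Proof. by rewrite jUE !jmul1; lmod R. Qed.

Lemma jU1r a : jU a jone = a ∘ a.
Proof. by rewrite jUE !jmulr1; lmod R. Qed.

(* In a set of pairwise operator-commuting elements closed under products,
   [L_p] behaves like multiplication by (p(s) + p(t)) / 2, so that [U_p] is
   multiplication by p(s) p(t) and hence multiplicative in p. *)
Lemma jU_mul C p q v : assoc_subalg C -> C p -> C q ->
  jU p (jU q v) = jU (p ∘ q) v.
Proof.
move=> hC Cp Cq.
have CA : C (p ∘ p) by exact: asubM.
have CB : C (q ∘ q) by exact: asubM.
have CD : C (p ∘ q) by exact: asubM.
have sqr_pq : (p ∘ q) ∘ (p ∘ q) = (p ∘ p) ∘ (q ∘ q).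
  rewrite (asubC hC CD Cp) (jmulC (p ∘ q) q) (asubC hC CA Cq) (jmulC _ q).
  by rewrite (jmulC (p ∘ p) q) (asubC hC Cq Cp p) (jmulC q p) (asubC hC Cp Cq).
(* [E1] and [E2] expand multiplication by p^2 q^2 along two groupings. Once the commuting operators
   are put in one order, the claim is the combination 2 [E2] - [E1]. *)
have E1 := jmul_op_mul3 (p ∘ p) q q v.
have E2 := jmul_op_mul3 (p ∘ q) p q v.
rewrite sqr_pq in E2.
rewrite (jmulC (p ∘ p) q) (jmul_op_mul3 q p p) in E1.
rewrite (asubC hC Cq Cp q) (jmulC _ p) (jmulC p q) (asubC hC Cp Cq p) in E2.
rewrite (jmulC q p) (jmul_op_mul3 q p p) (jmul_op_mul3 p q q) (jmulC q p) in E2.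
rewrite (jmulC q p) in E1; rewrite !jUE sqr_pq.
move: (p ∘ p) (q ∘ q) (p ∘ q) CA CB CD sqr_pq E1 E2 => A B D CA CB CD _ E1 E2.
have comm := (asubC hC Cq Cp, asubC hC CA Cp, asubC hC CA Cq,
              asubC hC CB Cp, asubC hC CB Cq, asubC hC CD Cp, asubC hC CD Cq).
rewrite !jmulE !comm in E1 E2 *.
by apply: (eq_lincomb2 (k := 2) (k' := -1) E2 E1); lmod R.
Qed.

(** * Powers and polynomials in one element *)

Section Powers.
Variable a : V.

Definition jpown n : V := iter n (jmul a) jone.

(** By [jmul_op_mul3], multiplication by a^(n+2) = a (a a^n) is a polynomial in the multiplications
    by a, a^2, a^n and a^(n+1). The induction therefore carries two consecutive powers. *)
Lemma jcommute_jpown w :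
  jcommute w a -> jcommute w (a ∘ a) -> forall n, jcommute w (jpown n).
Proof.
move=> wa wa2 n.
suff [] : jcommute w (jpown n) /\ jcommute w (jpown n.+1) by [].
elim: n => [|n [IH0 IH1]].
  by split=> v; rewrite /jpown /= ?jmul1 ?jmulr1.
split=> // v; rewrite /jpown /= !jmul_op_mul3 -!/(jpown _).
rewrite !(jmulC _ a) -/(jpown n.+1) !jmulE.
by rewrite !(wa, wa2, IH0, IH1).
Qed.

Lemma jcommute_jpown_base n : jcommute a (jpown n).
Proof. by apply: jcommute_jpown => //; exact: jcommute_sqr. Qed.

Lemma jpownC m n : jcommute (jpown m) (jpown n).
Proof.
apply: jcommute_jpown => v; first by rewrite jcommute_jpown_base.
by rewrite -(jcommute_jpown (w := a ∘ a)) // => w; rewrite -jcommute_sqr.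
Qed.

Lemma jpownD m n : jpown m ∘ jpown n = jpown (m + n).
Proof.
elim: m => [|m IH]; first by rewrite jmul1.
by rewrite addSn /= -IH jmulC -jcommute_jpown_base (jmulC (jpown n)).
Qed.

Definition pa (p : {poly R}) : V := \sum_(i < size p) p`_i *: jpown i.

Lemma paE n (p : {poly R}) : (size p <= n)%N -> pa p = \sum_(i < n) p`_i *: jpown i.
Proof.
move=> le; rewrite /pa (big_ord_widen _ (fun i => p`_i *: jpown i) le).
rewrite big_mkcond; apply: eq_bigr => i _; case: ltnP => // le'.
by rewrite nth_default // scale0r.
Qed.

Lemma pa_is_linear : linear pa.
Proof.
move=> k p q; set n := maxn (size p) (size q).
have hp : (size p <= n)%N by exact: leq_maxl.
have hq : (size q <= n)%N by exact: leq_maxr.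
have hpq : (size (k *: p + q)%R <= n)%N.
  rewrite (leq_trans (size_polyD _ _)) // geq_max hq andbT.
  by rewrite (leq_trans (size_scale_leq _ _)).
rewrite (paE hp) (paE hq) (paE hpq) scaler_sumr -big_split /=.
by apply: eq_bigr => i _; rewrite coefD coefZ scalerDl scalerA.
Qed.

HB.instance Definition _ :=
  GRing.isLinear.Build R {poly R} V *:%R pa pa_is_linear.

Lemma paXn n : pa 'X^n = jpown n.
Proof.
rewrite (@paE n.+1) ?size_polyXn // (bigD1 ord_max) //= big1 => [|i].
  by rewrite coefXn eqxx scale1r addr0.
by rewrite -val_eqE /= coefXn => /negPf->; rewrite scale0r.
Qed.

Lemma paC k : pa k%:P = k *: jone.
Proof. by rewrite -alg_polyC linearZ /= -[1](expr0 'X) paXn. Qed.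

Lemma paX : pa 'X = a.
Proof. by rewrite -['X]expr1 paXn /= /jpown /= jmulr1. Qed.

Lemma pa1 : pa 1 = jone.
Proof. by rewrite -[1](expr0 'X) paXn. Qed.

Lemma poly_linear_ind (P : {poly R} -> Prop) :
  (forall p q, P p -> P q -> P (p + q)) -> (forall k n, P (k *: 'X^n)) ->
  forall p, P p.
Proof.
move=> PD PX p; rewrite -[p]coefK poly_def.
apply: big_ind => [|p1 p2|i _]; [by rewrite -(scale0r 'X^0)|exact: PD|exact: PX].
Qed.

Lemma pa_commute p q : jcommute (pa p) (pa q).
Proof.
move=> v; elim/poly_linear_ind: p => [p p' IH IH'|k n].
  by rewrite linearD /= !jmulE IH IH'.
rewrite linearZ /= paXn !jmulE; congr (_ *: _).
elim/poly_linear_ind: q => [q q' IH IH'|l m].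
  by rewrite linearD /= !jmulE IH IH'.
by rewrite linearZ /= paXn !jmulE jpownC.
Qed.

Lemma paM p q : pa (p * q) = pa p ∘ pa q.
Proof.
elim/poly_linear_ind: p => [p p' IH IH'|k n].
  by rewrite mulrDl !linearD /= jmulDl IH IH'.
rewrite -scalerAl !linearZ /= jmulZl paXn; congr (_ *: _).
elim/poly_linear_ind: q => [q q' IH IH'|l m].
  by rewrite mulrDr !linearD /= jmulDr IH IH'.
by rewrite -scalerAr -exprD !linearZ /= jmulZr !paXn jpownD.
Qed.

End Powers.

Lemma pa_comp a p q : pa (pa a q) p = pa a (p \Po q).
Proof.
elim/poly_ind: p => [|p k IH]; first by rewrite comp_poly0 !linear0.
rewrite comp_polyD comp_polyM comp_polyX comp_polyC !linearD /=.
by rewrite !paM !paC paX IH.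
Qed.

(** Polarising at (a, a, x), the terms with a x = 1 vanish and [L_x, L_aa] = 0 remains. The two
    equations of an inverse are the base cases, and a^2 can then be pulled out of higher powers. *)
Lemma jpown_inv a x : a ∘ x = jone -> (a ∘ a) ∘ x = a ->
  forall n, x ∘ jpown a n.+1 = jpown a n.
Proof.
move=> ax a2x n.
have xa2 : jcommute x (a ∘ a).
  move=> v; have := jdefect_polar v a a x; rewrite /jdefect ax !jmulr1.
  by rewrite subrr !add0r => /subr0_eq; rewrite (jmulC v) (jmulC _ (a ∘ a)).
suff [] : x ∘ jpown a n.+1 = jpown a n /\ x ∘ jpown a n.+2 = jpown a n.+1 by [].
elim: n => [|n [IH0 IH1]].
  by rewrite /jpown /= !jmulr1 jmulC ax jmulC a2x.
split=> //; have j3 m : jpown a m.+2 = (a ∘ a) ∘ jpown a m.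
  by rewrite -(jpownD a 2 m) /jpown /= jmulr1.
by rewrite j3 xa2 IH0 -j3.
Qed.

(** The inverse [x] is not assumed to be a limit of polynomials in [a]; this is the link between
    invertibility in the whole algebra and in [Ca a]. *)
Lemma pa_inv a x : a ∘ x = jone -> (a ∘ a) ∘ x = a ->
  forall p, x ∘ (a ∘ pa a p) = pa a p.
Proof.
move=> ax a2x; elim/poly_linear_ind => [p q IH IH'|k n].
  by rewrite linearD /= !jmulDr IH IH'.
by rewrite linearZ /= !jmulZr paXn; congr (_ *: _); exact: jpown_inv.
Qed.

End AssociativeSubalgebra.

(** * The closed subalgebra generated by one element *)

Section Closure.
Context {R : realType}.

Lemma eps_le (u v K : R) : 0 <= K -> (forall e, 0 < e -> e <= 1 -> u <= v + e * K) ->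
  u <= v.
Proof.
move=> K0 h; apply/ler_addgt0Pr => e e0.
pose d := Num.min 1 (e / (K + 1)).
have K1 : 0 < K + 1 by lra.
have d0 : 0 < d by rewrite lt_min ltr01 divr_gt0.
have d1 : d <= 1 by rewrite ge_min lexx.
apply: (le_trans (h _ d0 d1)); rewrite lerD2l.
have de : d <= e / (K + 1) by rewrite ge_min lexx orbT.
apply: (le_trans (ler_wpM2r K0 de)); rewrite mulrAC ler_pdivrMr //.
by rewrite ler_pM2l //; lra.
Qed.

Lemma eps_eq0 (V : normedModType R) (u : V) (K : R) : 0 <= K ->
  (forall e, 0 < e -> e <= 1 -> `|u| <= e * K) -> u = 0.
Proof.
move=> K0 h; apply/eqP; rewrite -normr_le0; apply: (eps_le K0) => e e0 e1.
by rewrite add0r h.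
Qed.

Lemma closureP_norm (V : normedModType R) (S : set V) x :
  closure S x <-> forall e, 0 < e -> exists2 s, S s & `|x - s| <= e.
Proof.
split=> [h e e0|h B /nbhs_ballP[e /= e0 eB]].
  have [s [Ss]] := h _ (nbhsx_ballx x e e0).
  by rewrite -ball_normE /= => /ltW; exists s.
have [s Ss le] := h _ (divr_gt0 e0 (ltr0Sn R 1)).
exists s; split => //; apply: eB; rewrite -ball_normE /=.
by apply: (le_lt_trans le); lra.
Qed.

Lemma contraction_fixpoint (X : completeNormedModType R) (U : set X)
    (F : X -> X) (q : R) :
  closed U -> U !=set0 -> (forall x, U x -> U (F x)) -> 0 <= q < 1 ->
  (forall x y, U x -> U y -> `|F x - F y| <= q * `|x - y|) ->
  exists2 x, U x & x = F x.
Proof.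
move=> clU U0 UF /andP[q0 q1] FL.
have FU : {homo F : x / U x >-> U x} by move=> x /UF.
have [|x Ux xE] := @banach_fixed_point _ _ U (mkfun_fun FU) _ clU U0.
  by exists (NngNum q0); split=> //= -[x y] [/= Ux Uy]; exact: FL.
by exists x.
Qed.

End Closure.

Section ClosedSubalgebra.
Context {R : realType} {V : unitalJBAlgType R}.
Implicit Types (a b c x y z v w : V) (C : set V).

(** The norm of the unit equals its own square; the value 0 occurs in the zero algebra. *)
Lemma norm_jone_le1 : `|jone : V| <= 1.
Proof.
have := jb_norm_sqr (jone : V); rewrite jmul1; nra.
Qed.

Lemma normZ_jone (k : R) : 0 <= k -> `|k *: (jone : V)| <= k.
Proof.
by move=> k0; rewrite normrZ ger0_norm // ler_piMr // norm_jone_le1.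
Qed.

(* The closed subalgebra generated by a and the unit. *)
Definition Ca a : set V := closure (range (pa a)).

Lemma Ca_pa a p : Ca a (pa a p).
Proof. by apply: subset_closure; exists p. Qed.

Lemma Ca_id a : Ca a a.
Proof. by rewrite -{2}(paX a); exact: Ca_pa. Qed.

Lemma Ca1 a : Ca a jone.
Proof. by rewrite -(pa1 a); exact: Ca_pa. Qed.

Lemma Ca_closed a : closed (Ca a).
Proof. exact: closed_closure. Qed.

Arguments Ca_id : clear implicits.
Arguments Ca_closed : clear implicits.

Lemma CaP a x :
  Ca a x <-> forall e, 0 < e -> exists p, `|x - pa a p| <= e.
Proof.
rewrite /Ca closureP_norm; split=> h e /h.
  by case=> _ [p _ <-]; exists p.
by case=> p hp; exists (pa a p) => //; exists p.
Qed.

(** The commutator is continuous in [x]: replacing [x] by [s] changes it by at most 2 ‖x - s‖ ‖y‖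
    ‖v‖. *)
Lemma jcommute_closure (S : set V) x y :
  (forall s, S s -> jcommute s y) -> closure S x -> jcommute x y.
Proof.
move=> SC /closureP_norm Sx v; apply/eqP; rewrite -subr_eq0; apply/eqP.
apply: (@eps_eq0 _ _ _ (2 * (`|y| * `|v|))) => [|e e0 _].
  by rewrite !mulr_ge0.
have [s /SC sy le] := Sx _ e0.
have -> : x ∘ (y ∘ v) - y ∘ (x ∘ v) = (x - s) ∘ (y ∘ v) - y ∘ ((x - s) ∘ v).
  by rewrite !jmulE sy; lmod R.
have h1 := jb_normM (x - s) (y ∘ v); have h2 := jb_normM y v.
have h3 := jb_normM y ((x - s) ∘ v); have h4 := jb_normM (x - s) v.
have := ler_normB ((x - s) ∘ (y ∘ v)) (y ∘ ((x - s) ∘ v)).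
have : `|x - s| * `|y ∘ v| <= e * (`|y| * `|v|) by rewrite ler_pM.
have : `|y| * `|(x - s) ∘ v| <= `|y| * (e * `|v|).
  by rewrite ler_wpM2l // (le_trans h4) // ler_wpM2r.
lra.
Qed.

Lemma Ca_subalg a : assoc_subalg (Ca a).
Proof.
split; first exact: Ca1.
- move=> x y /CaP hx /CaP hy; apply/CaP => e e0.
  have e2 : 0 < e / 2 by lra.
  have [p hp] := hx _ e2; have [q hq] := hy _ e2.
  exists (p + q); rewrite linearD /= opprD addrACA.
  by apply: (le_trans (ler_normD _ _)); lra.
- move=> k x /CaP hx; apply/CaP => e e0.
  have k1 : 0 < `|k| + 1 by rewrite ltr_wpDl.
  have [p hp] := hx _ (divr_gt0 e0 k1).
  exists (k *: p); rewrite linearZ /= -scalerBr normrZ.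
  apply: (le_trans (ler_wpM2l (normr_ge0 _) hp)).
  by rewrite mulrCA ler_piMr ?(ltW e0) // ler_pdivrMr // mul1r; lra.
- move=> x y /CaP hx /CaP hy; apply/CaP => e e0.
  have y1 : 0 < 2 * (`|y| + 1) by rewrite mulr_gt0 // ltr_wpDl.
  have [p hp] := hx _ (divr_gt0 e0 y1).
  have p1 : 0 < 2 * (`|pa a p| + 1) by rewrite mulr_gt0 // ltr_wpDl.
  have [q hq] := hy _ (divr_gt0 e0 p1).
  exists (p * q); rewrite paM.
  have -> : x ∘ y - pa a p ∘ pa a q = (x - pa a p) ∘ y + pa a p ∘ (y - pa a q).
    by rewrite !jmulE; lmod R.
  apply: (le_trans (ler_normD _ _)).
  have h1 := jb_normM (x - pa a p) y; have h2 := jb_normM (pa a p) (y - pa a q).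
  have h3 : `|x - pa a p| * `|y| <= e / 2.
    apply: (le_trans (ler_wpM2r (normr_ge0 y) hp)).
    by rewrite mulrAC ler_pdivrMr //; nra.
  have h4 : `|pa a p| * `|y - pa a q| <= e / 2.
    apply: (le_trans (ler_wpM2l (normr_ge0 _) hq)).
    by rewrite mulrA ler_pdivrMr // [`|_| * e]mulrC; nra.
  lra.
(* The closure is taken in one argument at a time, with symmetry in between. *)
- move=> x y Cx Cy; apply: jcommute_closure Cx => _ [p _ <-] v; symmetry.
  by apply: jcommute_closure Cy v => _ [q _ <-]; exact: pa_commute.
Qed.

(** * Inverses and square roots by fixed points *)

Section Positive.
Variable C : set V.
Hypotheses (hC : assoc_subalg C) (clC : closed C).

Lemma asub_scal1 (k : R) : C (k *: jone).
Proof. by apply: asubZ => //; exact: asub1. Qed.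

(** The inverse is the fixed point of y -> 1 + z y, that is, the Neumann series. *)
Lemma asub_inv1B z : C z -> `|z| < 1 -> exists2 y, C y & (jone - z) ∘ y = jone.
Proof.
move=> Cz z1.
have [|||| y Cy yE] := @contraction_fixpoint _ _ C (fun y => jone + z ∘ y) `|z| clC.
- by exists jone; exact: asub1.
- by move=> x Cx; apply: asubD => //; [exact: asub1|exact: asubM].
- by rewrite normr_ge0.
- move=> x y _ _; rewrite opprD addrACA subrr add0r -jmulBr; exact: jb_normM.
by exists y => //; rewrite jmulBl jmul1 {1}yE addrK.
Qed.

(** With s = 1 - y the equation becomes y = (z + y^2) / 2, whose right side maps the ball of radius
    ‖z‖ to itself and contracts it with ratio ‖z‖. *)
Lemma asub_sqrt1B z : C z -> `|z| < 1 -> exists2 s, C s & s ∘ s = jone - z.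
Proof.
move=> Cz z1; pose U := C `&` [set y | `|y| <= `|z|].
have clU : closed U.
  apply: closedI => //.
  suff -> : [set y | `|y| <= `|z|] = closed_ball_ (@Num.norm R V) 0 `|z|.
    exact: closed_closed_ball_.
  by apply/seteqP; split => y; rewrite /closed_ball_ /= sub0r normrN.
have [|||| y [Cy _] yE] :=
  @contraction_fixpoint _ _ U (fun y => 2^-1 *: (z + y ∘ y)) `|z| clU.
- by exists z; split => /=.
- move=> x [Cx /= xz]; split => /=.
    by apply: asubZ => //; apply: asubD => //; exact: asubM.
  rewrite normrZ gtr0_norm ?invr_gt0 //.
  have := ler_normD z (x ∘ x); have := jb_normM x x.
  have := normr_ge0 x; have := normr_ge0 z; nra.
- by rewrite normr_ge0.
- move=> x y [_ /= xz] [_ /= yz].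
  rewrite -scalerBr normrZ gtr0_norm ?invr_gt0 //.
  have -> : z + x ∘ x - (z + y ∘ y) = (x - y) ∘ (x + y).
    by rewrite !jmulE (jmulC y x); lmod R.
  have h1 := jb_normM (x - y) (x + y); have h2 := ler_normD x y.
  have h3 : `|x - y| * `|x + y| <= `|x - y| * (2 * `|z|).
    by rewrite ler_wpM2l //; lra.
  lra.
exists (jone - y); first by apply: asubB => //; exact: asub1.
rewrite !jmulE !jmul1 !jmulr1.
by apply: (eq_lincomb1 (k := -2) yE); lmod R.
Qed.

Lemma asub_invB z (t : R) : C z -> `|z| < t ->
  exists2 y, C y & (t *: jone - z) ∘ y = jone.
Proof.
move=> Cz zt; have t0 : 0 < t by exact: le_lt_trans zt.
have Cz' : C (t^-1 *: z) by exact: asubZ.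
have [|y Cy yE] := asub_inv1B Cz'.
  by rewrite normrZ gtr0_norm ?invr_gt0 // ltr_pdivrMl // mulr1.
exists (t^-1 *: y); first exact: asubZ.
rewrite -[RHS]yE jmulZr -jmulZl; congr (_ ∘ _).
by rewrite scalerBr !scalerA mulVf ?scale1r // gt_eqF.
Qed.

Lemma asub_sqrtB z (t : R) : C z -> `|z| < t ->
  exists2 s, C s & s ∘ s = t *: jone - z.
Proof.
move=> Cz zt; have t0 : 0 < t by exact: le_lt_trans zt.
have Cz' : C (t^-1 *: z) by exact: asubZ.
have [|s Cs sE] := asub_sqrt1B Cz'.
  by rewrite normrZ gtr0_norm ?invr_gt0 // ltr_pdivrMl // mulr1.
exists (Num.sqrt t *: s); first exact: asubZ.
rewrite jmulZl jmulZr sE scalerA -expr2 sqr_sqrtr ?(ltW t0) //.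
by rewrite scalerBr scalerA mulfV ?scale1r // gt_eqF.
Qed.

End Positive.

(* Equivalent to [jpositive] (see [jpositiveP]), but visibly a closed convex
   cone. *)
Definition npos x := exists t : R, `|t *: jone - x| <= t.

(** x + t = (T + t) - (T - x), and ‖T - x‖ <= T < T + t. *)
Lemma npos_sqrt C x (t : R) : assoc_subalg C -> closed C -> C x -> npos x ->
  0 < t -> exists2 s, C s & s ∘ s = x + t *: jone.
Proof.
move=> hC clC Cx [T hT] t0.
have [||s Cs sE] := @asub_sqrtB C hC clC (T *: jone - x) (T + t).
- by apply: asubB => //; exact: asub_scal1.
- by apply: (le_lt_trans hT); lra.
by exists s => //; rewrite sE; lmod R.
Qed.

(** Any bound of the norm serves as the witness in [npos]. With s^2 = x + e and w^2 = T + 2e - s^2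
    the norm axiom gives ‖w^2‖ <= ‖w^2 + s^2‖ <= T + 2e, and e tends to 0. *)
Lemma npos_norm x (T : R) : npos x -> `|x| <= T -> `|T *: jone - x| <= T.
Proof.
move=> px xT; apply: (@eps_le _ _ _ 3) => // e e0 e1.
have [s Cs sE] := npos_sqrt (Ca_subalg x) (Ca_closed x) (Ca_id x) px e0.
have [||w Cw wE] := asub_sqrtB (Ca_subalg x) (Ca_closed x)
  (z := x + e *: jone) (t := T + 2 * e).
- by rewrite -sE; exact: (asubM (Ca_subalg x) Cs Cs).
- have := ler_normD x (e *: jone); have := normZ_jone (ltW e0); lra.
have := jb_norm_sqrD w s; rewrite wE sE.
have -> : (T + 2 * e) *: jone - (x + e *: jone) + (x + e *: jone) =
  (T + 2 * e) *: jone by lmod R.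
have T0 : 0 <= T + 2 * e by have := normr_ge0 x; lra.
have := normZ_jone T0; have := normZ_jone (ltW e0).
have -> : T *: jone - x = ((T + 2 * e) *: jone - (x + e *: jone)) - e *: jone.
  by lmod R.
have := ler_normB ((T + 2 * e) *: jone - (x + e *: jone)) (e *: jone).
lra.
Qed.

(** If w^2 = T - x^2 with T = ‖x^2‖ + 1, then ‖w^2‖ <= ‖w^2 + x^2‖ <= T. *)
Lemma npos_sqr x : npos (x ∘ x).
Proof.
exists (`|x ∘ x| + 1).
have [||w Cw wE] := asub_sqrtB (Ca_subalg x) (Ca_closed x)
  (z := x ∘ x) (t := `|x ∘ x| + 1).
- exact: (asubM (Ca_subalg x) (Ca_id x) (Ca_id x)).
- by lra.
rewrite -wE; apply: (le_trans (jb_norm_sqrD w x)); rewrite wE subrK.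
by apply: normZ_jone; rewrite addr_ge0.
Qed.

Lemma nposD x y : npos x -> npos y -> npos (x + y).
Proof.
move=> [s hs] [t ht]; exists (s + t).
have -> : (s + t) *: jone - (x + y) = (s *: jone - x) + (t *: jone - y) by lmod R.
by apply: (le_trans (ler_normD _ _)); lra.
Qed.

Lemma nposZ (k : R) x : 0 <= k -> npos x -> npos (k *: x).
Proof.
move=> k0 [t ht]; exists (k * t); rewrite -scalerA -scalerBr normrZ ger0_norm //.
exact: ler_wpM2l.
Qed.

Lemma npos_scal1 (k : R) : 0 <= k -> npos (k *: jone : V).
Proof. by move=> k0; exists k; rewrite subrr normr0. Qed.

Lemma npos_norm1B x (T : R) : `|x| <= T -> npos (T *: jone - x).
Proof. by move=> h; exists T; rewrite opprB addrC subrK. Qed.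

(** By [npos_norm] the witness ‖x‖ + 1 works for all close approximants at once, hence in the
    limit. *)
Lemma npos_closed x :
  (forall e, 0 < e -> exists2 y, npos y & `|x - y| <= e) -> npos x.
Proof.
move=> h; exists (`|x| + 1); apply: (@eps_le _ _ _ 1) => // e e0 e1.
have [y py xy] := h _ e0; rewrite distrC in xy.
have := ler_normD x (y - x); rewrite addrCA subrr addr0 => xyx.
have yT : `|y| <= `|x| + 1 by lra.
have := npos_norm py yT.
have -> : (`|x| + 1) *: jone - x = ((`|x| + 1) *: jone - y) + (y - x) by lmod R.
have := ler_normD ((`|x| + 1) *: jone - y) (y - x); lra.
Qed.

(** * Positivity inside a closed associative subalgebra *)

Section PositiveIn.
Variable C : set V.
Hypotheses (hC : assoc_subalg C) (clC : closed C).

(** If s^2 = x + t and r^2 = y + t, then (s r)^2 = (x + t)(y + t), which differs from x y by t (x +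
    y + t); the cone is closed. *)
Lemma npos_mul x y : C x -> C y -> npos x -> npos y -> npos (x ∘ y).
Proof.
move=> Cx Cy px py; apply: npos_closed => e e0.
pose K := `|x| + `|y| + 1.
have K0 : 0 < K by rewrite ltr_wpDl // addr_ge0.
pose t := Num.min 1 (e / K).
have t0 : 0 < t by rewrite lt_min ltr01 divr_gt0.
have t1 : t <= 1 by rewrite ge_min lexx.
have tK : t * K <= e by rewrite -ler_pdivlMr // ge_min lexx orbT.
have [s Cs sE] := npos_sqrt hC clC Cx px t0.
have [r Cr rE] := npos_sqrt hC clC Cy py t0.
exists ((x + t *: jone) ∘ (y + t *: jone)).
  have -> : (x + t *: jone) ∘ (y + t *: jone) = (s ∘ r) ∘ (s ∘ r).
    have Csr : C (s ∘ r) by exact: asubM.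
    rewrite -sE -rE (asubC hC Csr Cs) (jmulC (s ∘ r)) (asubC hC Cr Cs).
    by rewrite [RHS](asubA _ hC) //; exact: asubM.
  exact: npos_sqr.
have -> : x ∘ y - (x + t *: jone) ∘ (y + t *: jone) =
    - (t *: (x + y + t *: jone)).
  by rewrite !jmulE !jmul1 !jmulr1; lmod R.
rewrite normrN normrZ gtr0_norm //; apply: le_trans tK; rewrite ler_pM2l //.
have := ler_normD (x + y) (t *: jone); have := ler_normD x y.
by have := normZ_jone (ltW t0); rewrite /K; lra.
Qed.

(** The norm axiom for squares, applied to square roots of x + e and y + e. *)
Lemma npos_norm_le x y : C x -> C y -> npos x -> npos y -> `|x| <= `|x + y|.
Proof.
move=> Cx Cy px py; apply: (@eps_le _ _ _ 3) => // e e0 e1.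
have [s Cs sE] := npos_sqrt hC clC Cx px e0.
have [r Cr rE] := npos_sqrt hC clC Cy py e0.
have := jb_norm_sqrD s r; rewrite sE rE => h.
have e2 : 0 <= 2 * e by lra.
have := ler_normB (x + e *: jone) (e *: jone); rewrite addrK.
have := ler_normD (x + y) ((2 * e) *: jone).
have -> : x + y + (2 * e) *: jone = x + e *: jone + (y + e *: jone) by lmod R.
have := normZ_jone e2; have := normZ_jone (ltW e0); lra.
Qed.

(* [z ^ 2 + t] is invertible for t > 0, and for small t the lower bound on z
   makes [t / (z ^ 2 + t)] small in norm. *)
Lemma asub_inv_of_bounded_below z (e : R) : C z -> 0 < e ->
  (forall w, C w -> e * `|w| <= `|z ∘ w|) -> exists2 y, C y & z ∘ y = jone.
Proof.
(* With y inverse to z^2 + t one has e^2 ‖y‖ <= ‖z^2 y‖ <= 1 + t ‖y‖. As e^2 = 4 t, this gives t ‖y‖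
   <= 1/3, so 1 - t y = z^2 y is invertible. *)
move=> Cz e0 h; pose t := e ^+ 2 / 4.
have e20 : 0 < e ^+ 2 by rewrite exprn_gt0.
have t0 : 0 < t by rewrite divr_gt0.
have Cb : C (z ∘ z) by exact: asubM.
have [T hT] := npos_sqr z.
have [||y Cy yE] := asub_invB hC clC (z := T *: jone - z ∘ z) (t := T + t).
- by apply: asubB => //; exact: asub_scal1.
- by apply: (le_lt_trans hT); lra.
have by_ : (z ∘ z) ∘ y = jone - t *: y.
  apply: (eq_lincomb1 (k := 1) yE); rewrite !jmulE !jmul1; by lmod R.
have h2 : e ^+ 2 * `|y| <= `|(z ∘ z) ∘ y|.
  rewrite -(asubA _ hC) // expr2 -mulrA.
  have := h _ Cy; have := h _ (asubM hC Cz Cy).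
  move=> h3 h4; apply: le_trans h3; by rewrite ler_pM2l.
have h3 : `|(z ∘ z) ∘ y| <= 1 + t * `|y|.
  rewrite by_; apply: (le_trans (ler_normB _ _)).
  by rewrite normrZ gtr0_norm // lerD2r norm_jone_le1.
have ty : `|t *: y| < 1.
  rewrite normrZ gtr0_norm //.
  have : 3 * (t * `|y|) <= 1 by rewrite /t in h3 *; lra.
  lra.
have [|u Cu uE] := asub_inv1B hC clC (z := t *: y) _ ty; first exact: asubZ.
rewrite -by_ in uE.
exists (z ∘ (y ∘ u)); first by do !apply: asubM => //.
by rewrite (asubA _ hC) // ?(asubA _ hC) //; exact: asubM.
Qed.

(* If y were the inverse, (‖y‖ - y) (1 - b) >= 0 would give
   ‖y‖ b <= ‖y‖ - 1, contradicting ‖b‖ = 1. *)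
Lemma npos_norm1_not_inv b : C b -> npos b -> `|b| = 1 ->
  ~ exists2 y, C y & (jone - b) ∘ y = jone.
Proof.
move=> Cb pb b1 [y Cy yE].
have Cc : C (jone - b) by apply: asubB => //; exact: asub1.
have pc : npos (jone - b).
  by have := @npos_norm1B b 1; rewrite scale1r; apply; rewrite b1.
have py : npos y.
  have -> : y = (y ∘ y) ∘ (jone - b).
    by rewrite -(asubA _ hC) // (jmulC y (_ - _)) yE jmulr1.
  by apply: npos_mul => //; [exact: asubM|exact: npos_sqr].
have CM : C (`|y| *: jone - y) by apply: asubB => //; exact: asub_scal1.
have := npos_mul CM Cc (npos_norm1B (lexx `|y|)) pc.
have CMb : C (`|y| *: b) by exact: asubZ.
have pMb : npos (`|y| *: b) by exact: nposZ.
have CMc := asubM hC CM Cc.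
move=> /(npos_norm_le CMb CMc pMb).
have -> : `|y| *: b + (`|y| *: jone - y) ∘ (jone - b) = (`|y| - 1) *: jone.
  rewrite jmulBl (jmulC y) yE jmulZl jmul1; by lmod R.
have c1 : `|jone - b| <= 1.
  have := @npos_norm b 1; rewrite scale1r; apply => //; by rewrite b1.
have j1 : `|jone : V| = 1.
  apply: (@mulfI _ `|jone : V|); last by rewrite mulr1 -expr2 -jb_norm_sqr jmul1.
  rewrite normr_eq0; apply/eqP => j0; move: b1.
  by rewrite -(jmul1 b) j0 jmul0l normr0 => /eqP; rewrite eq_sym oner_eq0.
have y1 : 1 <= `|y|.
  rewrite -j1 -yE; apply: (le_trans (jb_normM _ _)).
  by rewrite ler_piMl.
rewrite !normrZ j1 b1 !mulr1 normr_id ger0_norm ?subr_ge0 //; lra.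
Qed.

End PositiveIn.

End ClosedSubalgebra.

Arguments Ca_id {R V} a.
Arguments Ca_closed {R V} a.
Arguments Ca_pa {R V} a p.

(** * Spectrum *)

Section RealPolynomials.
Context {R : rcfType}.
Import complex.

(** Take a complex root. If it is not real, the remainder of [p] modulo its real quadratic has
    degree at most 1 and a nonreal root, so it is 0. *)
Lemma real_poly_factor (p : {poly R}) : (1 < size p)%N ->
  (exists l q, p = q * ('X - l%:P)) \/
  (exists u v q, v != 0 /\ p = q * (('X - u%:P) ^+ 2 + (v ^+ 2)%:P)).
Proof.
move=> p1; pose f : {rmorphism R -> R[i]} := real_complex R.
have [z rz] : exists z, root (map_poly f p) z.
  by apply/closed_rootP; rewrite size_map_poly; case: (size p) p1 => [|[]].
have [z0|z0] := eqVneq (Im z) 0.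
  left; exists (Re z).
  have zE : z = f (Re z) by move: z0; case: (z) => x y /= ->.
  by move: rz; rewrite zE fmorph_root => /factor_theorem[q ->]; exists q.
right; exists (Re z), (Im z).
set d := _ + _; exists (p %/ d); split => //.
have d0 : size d = 3%N.
  rewrite /d size_polyDl; first by rewrite size_exp_XsubC.
  by rewrite size_exp_XsubC (leq_ltn_trans (size_polyC_leq1 _)).
have dz : root (map_poly f d) z.
  rewrite /root /d rmorphD rmorphXn /= rmorphB /= map_polyX !map_polyC /= !hornerE.
  rewrite {1}(complexE z) [_ + 'i%C * _]addrC addrK exprMn sqr_i mulN1r.
  by rewrite -rmorphXn /= addNr.
suff r0 : p %% d = 0 by rewrite {1}(divp_eq p d) r0 addr0.
have rs : (size (p %% d)%R <= 2)%N by rewrite -ltnS -d0 ltn_modp -size_poly_eq0 d0.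
have rE : p %% d = ((p %% d)`_0)%:P + (p %% d)`_1 *: 'X.
  apply/polyP => i; rewrite coefD coefC coefZ coefX.
  case: i => [|[|i]] /=; rewrite ?mulr0 ?mulr1 ?addr0 ?add0r //.
  by rewrite nth_default // (leq_trans rs).
have : root (map_poly f (p %% d)) z.
  have h : map_poly f p = map_poly f (p %/ d) * map_poly f d + map_poly f (p %% d).
    by rewrite -rmorphM -rmorphD -divp_eq.
  by move: rz; rewrite h /root hornerD hornerM (rootP dz) mulr0 add0r.
rewrite rE; move: (_`_0) (_`_1) => r0 r1.
rewrite /root rmorphD /= map_polyC map_polyZ map_polyX /= !hornerE.
case: z z0 {rz dz} d d0 rs rE => x y /= y0 _ _ _ _.
rewrite eq_complex /=; simpc => /andP[/eqP h1].
rewrite mulf_eq0 (negPf y0) orbF => /eqP r10.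
by move: h1; rewrite r10 mul0r addr0 => ->; rewrite scale0r addr0.
Qed.

End RealPolynomials.

Section Spectrum.
Context {R : realType} {V : unitalJBAlgType R}.
Implicit Types (a b x y z w : V) (p q : {poly R}).

(* p(a) is a polynomial in [a - l]. *)
Lemma Ca_shift a (l : R) x : Ca a x -> Ca (a - l *: jone) x.
Proof.
move=> /CaP h; apply/CaP => e /h[p hp].
exists (p \Po ('X + l%:P)); rewrite -pa_comp.
by rewrite linearD /= paX paC subrK.
Qed.

(** A quantitative form of invertibility in [Ca a], stable under products and small
    perturbations. *)
Definition bounded_below a z :=
  exists2 e : R, 0 < e & forall w, Ca a w -> e * `|w| <= `|z ∘ w|.

Lemma bounded_below_inv a z : Ca a z -> bounded_below a z ->
  exists2 y, Ca a y & z ∘ y = jone.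
Proof.
move=> Cz [e e0 h].
exact: (asub_inv_of_bounded_below (Ca_subalg a) (Ca_closed a) Cz e0 h).
Qed.

Lemma bounded_below_mul a z z' : Ca a z -> Ca a z' ->
  bounded_below a z -> bounded_below a z' -> bounded_below a (z ∘ z').
Proof.
move=> Cz Cz' [e e0 h] [e' e0' h']; exists (e * e'); first exact: mulr_gt0.
move=> w Cw; rewrite -(asubA _ (Ca_subalg a)) //.
apply: le_trans (h _ (asubM (Ca_subalg a) Cz' Cw)).
by rewrite -mulrA ler_pM2l // h'.
Qed.

(* The norm axiom ‖x^2‖ <= ‖x^2 + y^2‖ excludes complex spectrum. *)
Lemma bounded_below_sqrD a z (v : R) : Ca a z -> v != 0 ->
  bounded_below a (z ∘ z + v ^+ 2 *: jone).
Proof.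
move=> Cz v0; have hC := Ca_subalg a.
have v2 : 0 < v ^+ 2 by rewrite exprn_even_gt0.
exists (v ^+ 2) => // w Cw.
have [->|w0] := eqVneq w 0; first by rewrite normr0 mulr0.
rewrite -(ler_pM2r (x := `|w|)) ?normr_gt0 //.
apply: le_trans (jb_normM _ _).
have -> : ((z ∘ z + v ^+ 2 *: jone) ∘ w) ∘ w =
    (v *: w) ∘ (v *: w) + (z ∘ w) ∘ (z ∘ w).
  have Czw : Ca a (z ∘ w) := asubM hC Cz Cw.
  rewrite !jmulE jmul1 !scalerA expr2 (asubC hC Czw Cz) (jmulC (z ∘ w)).
  rewrite (asubC hC Cw Cz) (asubA _ hC Cz (asubM hC Cw Cw)).
  by rewrite -(asubA _ hC (asubM hC Cz Cz) Cw) addrC.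
apply: le_trans (jb_norm_sqrD _ _).
by rewrite jb_norm_sqr normrZ exprMn real_normK ?num_real // -mulrA -expr2.
Qed.

(** The inverse [x] of a - l undoes multiplication by a - l on polynomials in a - l, and by density
    on [Ca a]; hence ‖w‖ <= ‖x‖ ‖(a - l) w‖. *)
Lemma notin_Sp_bounded_below a (l : R) : ~ Sp a l ->
  bounded_below a (a - l *: jone).
Proof.
move=> /contrapT[x [x1 x2]]; exists (`|x| + 1)^-1.
  by rewrite invr_gt0 ltr_wpDl.
move=> w /(@Ca_shift _ l) Cw; rewrite ler_pdivrMl ?ltr_wpDl //.
suff xE : x ∘ ((a - l *: jone) ∘ w) = w.
  rewrite -{1}xE; apply: (le_trans (jb_normM _ _)).
  by rewrite ler_wpM2r // lerDl.
apply/eqP; rewrite -subr_eq0; apply/eqP.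
move: (a - l *: jone) x1 x2 Cw => c x1 x2 Cw.
apply: (@eps_eq0 _ _ _ (`|x| * `|c| + 1)); first by rewrite addr_ge0 // mulr_ge0.
move=> e e0 _; have [p hp] := (CaP _ _).1 Cw _ e0.
have := pa_inv x1 x2 p => pE.
have -> : x ∘ (c ∘ w) - w = x ∘ (c ∘ (w - pa c p)) - (w - pa c p).
  by rewrite !(jmulBr, jmulE) pE; lmod R.
apply: (le_trans (ler_normB _ _)).
rewrite mulrDr mulr1 lerD // (le_trans (jb_normM _ _)) // mulrCA.
rewrite ler_wpM2l // (le_trans (jb_normM _ _)) // mulrC.
by rewrite ler_wpM2r.
Qed.

Lemma Ca_X_sub a (l : R) : Ca a (a - l *: jone).
Proof.
apply: asubB (Ca_subalg a) _ _; first exact: Ca_id.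
exact: asub_scal1 (Ca_subalg a) _.
Qed.

Arguments Ca_X_sub : clear implicits.

Lemma notin_Sp a (l : R) :
  (exists2 y, Ca a y & (a - l *: jone) ∘ y = jone) -> ~ Sp a l.
Proof.
move=> [y Cy yE] /=; apply; exists y; split => //.
have Cc := Ca_X_sub a l.
by rewrite -(asubA _ (Ca_subalg a) Cc Cy) yE jmulr1.
Qed.

(** Induction on the degree: a real linear factor has its root outside the spectrum, and an
    irreducible quadratic factor is covered by [bounded_below_sqrD]. *)
Lemma pa_bounded_below a p : p != 0 -> (forall l, Sp a l -> p.[l] != 0) ->
  bounded_below a (pa a p).
Proof.
have hC := Ca_subalg a.
elim: {p}(size p) {-2}p (leqnn (size p)) => [|n IH] p sp p0 hp.
  by move: sp p0; rewrite leqn0 size_poly_eq0 => ->.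
have [p1|p1] := leqP (size p) 1.
  have c0 : p`_0 != 0.
    by move: p0; rewrite [p]size1_polyC // polyC_eq0 coefC.
  exists `|p`_0|; first by rewrite normr_gt0.
  by move=> w _; rewrite [p in pa a p]size1_polyC // paC jmulZl jmul1 normrZ.
have [[l [q pE]]|[u [v [q [v0 pE]]]]] := real_poly_factor p1.
  have q0 : q != 0 by apply: contraNneq p0 => q0; rewrite pE q0 mul0r.
  have dE : pa a ('X - l%:P) = a - l *: jone by rewrite linearB /= paX paC.
  rewrite pE paM dE; apply: bounded_below_mul => //.
  - exact: Ca_pa.
  - exact: Ca_X_sub.
  - apply: IH => //.
      by move: sp; rewrite pE size_Mmonic ?monicXsubC // size_XsubC addn2.
    by move=> k /hp; rewrite pE hornerM mulf_eq0 negb_or => /andP[].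
  - apply: notin_Sp_bounded_below => /hp.
    by rewrite pE !hornerE subrr mulr0 eqxx.
have q0 : q != 0 by apply: contraNneq p0 => q0; rewrite pE q0 mul0r.
have dE : pa a (('X - u%:P) ^+ 2 + (v ^+ 2)%:P) =
    (a - u *: jone) ∘ (a - u *: jone) + v ^+ 2 *: jone.
  by rewrite linearD /= paC expr2 paM linearB /= paX paC.
have Cd : Ca a (pa a (('X - u%:P) ^+ 2 + (v ^+ 2)%:P)) by exact: Ca_pa.
rewrite pE paM; apply: bounded_below_mul => //; first exact: Ca_pa.
  apply: IH => //; last first.
    by move=> k /hp; rewrite pE hornerM mulf_eq0 negb_or => /andP[].
  have dm : ('X - u%:P) ^+ 2 + (v ^+ 2)%:P \is monic.
    rewrite monicE lead_coefDl ?size_exp_XsubC ?(leq_ltn_trans (size_polyC_leq1 _)) //.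
    by rewrite -monicE monic_exp // monicXsubC.
  move: sp; rewrite pE size_Mmonic // size_polyDl; last first.
    by rewrite size_exp_XsubC (leq_ltn_trans (size_polyC_leq1 _)).
  by rewrite size_exp_XsubC !addnS addn0 /= => /ltnW.
by rewrite dE; apply: bounded_below_sqrD => //; exact: Ca_X_sub.
Qed.

(** If q(l) > ‖q(a)‖, then q(l) - q(a) is invertible; it is divisible by a - l, which would then be
    invertible too. *)
Lemma Sp_norm_le a p (l : R) : Sp a l -> `|p.[l]| <= `|pa a p|.
Proof.
suff h q : Sp a l -> q.[l] <= `|pa a q|.
  move=> Sl; rewrite ler_norml h // andbT lerNl.
  by rewrite -hornerN -normrN -linearN h.
move=> Sl; rewrite leNgt; apply/negP => lt; move: Sl; apply: notin_Sp.
have hC := Ca_subalg a.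
have [y Cy yE] := asub_invB hC (Ca_closed a) (Ca_pa a q) lt.
have /factor_theorem[r rE] : root (q.[l]%:P - q) l.
  by rewrite /root !hornerE subrr.
have Cr := Ca_pa a r; have Cl := Ca_X_sub a l.
exists (pa a r ∘ y); first exact: (asubM hC Cr Cy).
rewrite -[RHS]yE -(paC a q.[l]) -linearB rE /= paM linearB /= paX paC (asubA _ hC) //.
by rewrite (jmulC (a - _)).
Qed.

(* Otherwise [m ^ 2 - p ^ 2], m = ‖p(a)‖, has no root in the spectrum. *)
Lemma Sp_norm_attained_aux a p : 0 < `|pa a p| ->
  (`|pa a p| ^+ 2)%:P - p ^+ 2 != 0 ->
  exists2 l, Sp a l & `|p.[l]| = `|pa a p|.
Proof.
set m := `|pa a p| => m0 r0; apply: contrapT => H.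
have hC := Ca_subalg a; have clC := Ca_closed a.
have Cp := Ca_pa a p.
have m2 : 0 < m ^+ 2 by rewrite exprn_gt0.
have : bounded_below a (pa a ((m ^+ 2)%:P - p ^+ 2)).
  apply: pa_bounded_below => // l Sl; rewrite !hornerE subr_eq0.
  apply/eqP => mp; apply: H; exists l => //.
  apply/eqP; rewrite -(@eqrXn2 _ 2) // ?(ltW m0) //.
  by rewrite real_normK ?num_real // mp.
move=> /(bounded_below_inv (Ca_pa _ _))[y Cy yE].
(* p(a)^2 / m^2 is positive of norm 1, so its difference from 1 has no inverse. *)
apply: (@npos_norm1_not_inv _ _ _ hC clC ((m ^- 2) *: (pa a p ∘ pa a p))).
- exact: (asubZ hC _ (asubM hC Cp Cp)).
- by apply: nposZ; [rewrite invr_ge0 ltW|exact: npos_sqr].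
- by rewrite normrZ jb_norm_sqr gtr0_norm ?invr_gt0 // mulVf // gt_eqF.
exists (m ^+ 2 *: y); first exact: (asubZ hC _ Cy).
have dE : pa a ((m ^+ 2)%:P - p ^+ 2) = m ^+ 2 *: jone - pa a p ∘ pa a p.
  by rewrite linearB /= paC [p ^+ 2]expr2 paM.
rewrite -[RHS]yE dE jmulZr -jmulZl; congr (_ ∘ _).
by rewrite scalerBr scalerA mulfV ?scale1r // gt_eqF.
Qed.

(** For a != 0 the norm of a is attained on the spectrum, since the polynomial m^2 - X^2 is not
    0. *)
Lemma Sp_neq0 a : jone != 0 :> V -> Sp a !=set0.
Proof.
move=> j0; have [a0|a0] := eqVneq a 0.
  exists 0 => -[x [+ _]]; rewrite a0 scale0r subr0 jmul0l => /esym/eqP.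
  by rewrite (negPf j0).
have [||l Sl _] := @Sp_norm_attained_aux a 'X.
- by rewrite paX normr_gt0.
- rewrite subr_eq0; apply/eqP => /(congr1 (fun p : {poly R} => size p)).
  by rewrite size_polyXn => h; have := size_polyC_leq1 (`|pa a 'X| ^+ 2); rewrite h.
- by exists l.
Qed.

(** If p(a) = 0 or p^2 is the constant ‖p(a)‖^2, any point of the spectrum will do. *)
Lemma Sp_norm_attained a p : jone != 0 :> V ->
  exists2 l, Sp a l & `|p.[l]| = `|pa a p|.
Proof.
move=> j0; have [l Sl] := Sp_neq0 a j0.
have [pa0|pa0] := eqVneq (pa a p) 0.
  exists l => //; apply/eqP; rewrite eq_le Sp_norm_le //.
  by rewrite pa0 normr0 normr_ge0.
have m0 : 0 < `|pa a p| by rewrite normr_gt0.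
have [/eqP r0|r0] := eqVneq ((`|pa a p| ^+ 2)%:P - p ^+ 2) 0; last first.
  exact: Sp_norm_attained_aux.
exists l => //; apply/eqP; rewrite -(@eqrXn2 _ 2) // real_normK ?num_real //.
by rewrite -horner_exp; move: r0; rewrite subr_eq0 => /eqP <-; rewrite hornerC.
Qed.

Lemma Sp_le_norm a (l : R) : Sp a l -> `|l| <= `|a|.
Proof. by move=> /(@Sp_norm_le _ 'X); rewrite hornerX paX. Qed.

(** A lower bound e for a - l survives a shift of l by less than e. *)
Lemma Sp_closed a : closed (Sp a).
Proof.
rewrite -[Sp a]setCK; apply: open_closedC; rewrite openE => l /=.
move=> /notin_Sp_bounded_below[e e0 h].
rewrite /interior; apply/nbhs_ballP; exists e => //= k.
rewrite -ball_normE /= => lk; apply: notin_Sp.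
apply: bounded_below_inv; first exact: Ca_X_sub.
exists (e - `|l - k|); first by rewrite subr_gt0.
move=> w Cw; have := h _ Cw.
have -> : (a - l *: jone) ∘ w = (a - k *: jone) ∘ w - (l - k) *: w.
  by rewrite !jmulE jmul1; lmod R.
have := ler_normB ((a - k *: jone) ∘ w) ((l - k) *: w).
by rewrite [`|_ *: w|]normrZ mulrBl; lra.
Qed.

Lemma Sp_compact a : compact (Sp a).
Proof.
apply: (subclosed_compact (@Sp_closed a) (@segment_compact _ (- `|a|) `|a|)).
by move=> l /Sp_le_norm /=; rewrite in_itv /= ler_norml.
Qed.

End Spectrum.
Arguments Ca_X_sub {R V} a l.

(** * The Weierstrass theorem on compact sets of reals *)

Section Weierstrass.
Context {R : realType}.
Implicit Types (f g : R -> R) (phi psi : nat -> R) (x y c d e M : R).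

(* The Bernstein polynomial with node values phi 0, ..., phi n, defined through
   Pascal's rule so that its moments follow by induction on n. *)
Fixpoint bernstein n phi : {poly R} :=
  if n is n.+1 then
    'X * bernstein n (phi \o succn) + (1 - 'X) * bernstein n phi
  else (phi 0%N)%:P.

Lemma bernsteinS n phi x : (bernstein n.+1 phi).[x] =
  x * (bernstein n (phi \o succn)).[x] + (1 - x) * (bernstein n phi).[x].
Proof. by rewrite /= !hornerE. Qed.

Lemma bernstein_le n phi psi x : 0 <= x <= 1 ->
  (forall k, (k <= n)%N -> phi k <= psi k) ->
  (bernstein n phi).[x] <= (bernstein n psi).[x].
Proof.
move=> /andP[x0 x1]; elim: n phi psi => [|n IH] phi psi h.
  by rewrite /= !hornerE h.
rewrite !bernsteinS lerD // ler_wpM2l ?subr_ge0 // IH // => k kn.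
  exact: h.
by apply: h; exact: leqW.
Qed.

(** Mean n x and variance n x (1 - x) of the binomial law. The free centre [c] absorbs the index
    shift in Pascal's rule. *)
Lemma bernstein_quad n (al be c : R) x :
  (bernstein n (fun k => al + be * (k%:R - c) ^+ 2)).[x] =
  al + be * ((n%:R * x - c) ^+ 2 + n%:R * x * (1 - x)).
Proof.
elim: n c => [|n IH] c; first by rewrite /= !hornerE; ring.
rewrite bernsteinS IH.
have -> : (fun k => al + be * (k%:R - c) ^+ 2) \o succn =
          (fun k => al + be * (k%:R - (c - 1)) ^+ 2).
  by apply/funext => k /=; rewrite -[k.+1]addn1 natrD; ring.
by rewrite IH -[n.+1]addn1 natrD; ring.
Qed.

(** The modulus encloses the node values between two quadratics in k centred at n x; monotonicity
    and the variance give the error C x (1 - x) / n. *)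
Lemma bernstein_approx g n (e C : R) : (0 < n)%N -> 0 <= C ->
  (forall x y, 0 <= x <= 1 -> `|g x - g y| <= e + C * (x - y) ^+ 2) ->
  forall x, 0 <= x <= 1 ->
  `|g x - (bernstein n (fun k => g (k%:R / n%:R))).[x]| <= e + C / n%:R.
Proof.
move=> n0 C0 h x x01; have /andP[x0 x1] := x01.
have nn0 : (n%:R : R) != 0 by rewrite pnatr_eq0 -lt0n.
have n0' : 0 < (n%:R : R) by rewrite ltr0n.
have bound (k : nat) : `|g x - g (k%:R / n%:R)| <=
    e + C / n%:R ^+ 2 * (k%:R - n%:R * x) ^+ 2.
  apply: (le_trans (h _ _ x01)); rewrite lerD2l le_eqVlt; apply/orP; left.
  by apply/eqP; field.
have xx : x * (1 - x) <= 1 by nra.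
have E : C / n%:R ^+ 2 * ((n%:R * x - n%:R * x) ^+ 2 + n%:R * x * (1 - x)) =
         C / n%:R * (x * (1 - x)) by field.
have le : C / n%:R * (x * (1 - x)) <= C / n%:R.
  by rewrite ler_piMr // divr_ge0 // ltW.
rewrite ler_norml; apply/andP; split.
- have := @bernstein_le n (fun k => g (k%:R / n%:R))
    (fun k => (g x + e) + C / n%:R ^+ 2 * (k%:R - n%:R * x) ^+ 2) x x01.
  rewrite bernstein_quad E => H; rewrite lerNl opprB lerBlDr.
  apply: le_trans (H _) _ => [k _|]; last by lra.
  by have := bound k; rewrite ler_norml => /andP[+ _]; lra.
- have := @bernstein_le n
    (fun k => (g x - e) + (- (C / n%:R ^+ 2)) * (k%:R - n%:R * x) ^+ 2)
    (fun k => g (k%:R / n%:R)) x x01.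
  rewrite bernstein_quad mulNr E => H; rewrite lerBlDr -lerBlDl.
  apply: le_trans (H _) => [|k _]; first by lra.
  by have := bound k; rewrite ler_norml => /andP[_]; lra.
Qed.

(* Uniform continuity in the shape that the second moment estimate consumes. *)
Lemma quadratic_modulus g (K : set R) M e : continuous g ->
  (forall x, `|g x| <= M) -> compact K -> 0 < e ->
  exists2 C : R, 0 <= C & forall x y, K x -> `|g x - g y| <= e + C * (x - y) ^+ 2.
Proof.
move=> gc gM /compact_near_coveringP Kc e0.
have M0 : 0 <= M := le_trans (normr_ge0 _) (gM 0).
pose P (C x : R) := forall y, `|g x - g y| <= e + C * (x - y) ^+ 2.
have [|C0 [_ CK]] := Kc R (pinfty_nbhs R) P _.
  move=> x _; have /cvgrPdist_lt/(_ _ (divr_gt0 e0 (ltr0Sn R 1))) := gc x.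
  move=> /nbhs_ballP[d /= d0 dg].
  have d2 : 0 < d / 2 by rewrite divr_gt0.
  (* At distance at least d / 2 the quadratic term is at least C d^2 / 4 > 2 M, more than any
     difference of values of [g]. *)
  exists (ball x (d / 2), [set C | 8 * M / d ^+ 2 < C]).
    split; first exact: nbhsx_ballx.
    by exists (8 * M / d ^+ 2); split; [exact: num_real|].
  move=> [x' C] [/= xx' CM] y; rewrite /P.
  have C1 : 0 <= C by apply: le_trans (ltW CM); rewrite divr_ge0 ?sqr_ge0 // mulr_ge0.
  move: xx'; rewrite -ball_normE /= => xx'.
  have [yx|yx] := ltP `|x' - y| (d / 2).
    have xy : `|x - y| < d.
      by rewrite (le_lt_trans (ler_distD x' _ _)) //; lra.
    have h1 : `|g x - g x'| < e / 2.
      by apply: dg; rewrite -ball_normE /=; lra.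
    have h2 : `|g x - g y| < e / 2 by apply: dg; rewrite -ball_normE.
    have := ler_distD (g x) (g x') (g y); rewrite (distrC (g x') (g x)) => h3.
    have : 0 <= C * (x' - y) ^+ 2 by rewrite mulr_ge0 ?sqr_ge0.
    lra.
  have h1 := ler_normB (g x') (g y); have := gM x'; have := gM y.
  have : 2 * M <= C * (x' - y) ^+ 2.
    have dd : (d / 2) ^+ 2 <= (x' - y) ^+ 2.
      by rewrite -[leRHS]real_normK ?num_real // lerXn2r // nnegrE ?(ltW d2).
    apply: (le_trans _ (ler_wpM2l C1 dd)).
    have d20 : 0 < d ^+ 2 by rewrite exprn_gt0.
    move: CM; rewrite ltr_pdivrMr // => CM.
    by rewrite exprMn mulrA; lra.
  lra.
pose C := Num.max 0 (C0 + 1).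
exists C; first by rewrite le_max lexx.
move=> x y Kx; apply: CK Kx y; rewrite lt_max; apply/orP; right; lra.
Qed.

Lemma compact_subset_segment (K : set R) : compact K ->
  exists2 M : R, 0 < M & forall x, K x -> `|x| <= M.
Proof.
move=> /compact_bounded[M [_ h]]; exists (`|M| + 1); first by rewrite ltr_wpDl.
by move=> x /h; apply; rewrite (le_lt_trans (ler_norm M)) // ltrDl.
Qed.

(** Extend [f] to a bounded continuous function on the line, enclose [K] in [-N, N], and rescale to
    [0, 1] for the Bernstein polynomials. *)
Theorem weierstrass f (K : set R) : compact K -> {within K, continuous f} ->
  forall e, 0 < e -> exists p : {poly R}, forall x, K x -> `|f x - p.[x]| <= e.
Proof.
move=> Kc fc e e0.
have [M M0 fM] : exists2 M : R, 0 < M & forall x, K x -> `|f x| <= M.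
  have [M M0 h] := compact_subset_segment (continuous_compact fc Kc).
  by exists M => // x Kx; apply: h; exists x.
have [g [fg gc gM]] : exists g, [/\ {in K, f =1 g}, continuous g &
    forall x, `|g x| <= M].
  apply: continuous_bounded_extension => //; first exact: pseudometric_normal.
  by apply: compact_closed => //; exact: Rhausdorff.
have [N N0 KN] := compact_subset_segment Kc.
pose aff t : R := 2 * N * t - N.
have e2 : 0 < e / 2 by rewrite divr_gt0.
have [C C0 hC] := quadratic_modulus gc gM (@segment_compact R (- N) N) e2.
pose C' := C * (2 * N) ^+ 2.
have C'0 : 0 <= C' by rewrite mulr_ge0 // sqr_ge0.
have [n0 nC] : exists n, (0 < n)%N /\ C' / n%:R <= e / 2.
  exists (Num.truncn (C' / (e / 2))).+1; split => //.
  rewrite ler_pdivrMr ?ltr0n // -ler_pdivrMl // mulrC.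
  by apply/ltW; rewrite Num.Theory.truncnS_gt.
case: nC => n0_gt nC.
have := @bernstein_approx (g \o aff) n0 (e / 2) C' n0_gt C'0.
set b := bernstein _ _ => hb.
exists (b \Po ((2 * N)^-1 *: ('X + N%:P))) => x Kx.
rewrite horner_comp !hornerE.
have xN := KN _ Kx; move: xN; rewrite ler_norml => /andP[xN1 xN2].
set t := _ * (x + N).
have tE : aff t = x by rewrite /aff /t; field; lra.
have t01 : 0 <= t <= 1.
  have N2 : 0 < 2 * N by lra.
  by rewrite /t mulr_ge0 ?invr_ge0 ?(ltW N2) //=; [rewrite ler_pdivrMl //; lra|lra].
have := hb _ t t01; rewrite /= tE fg ?inE // => H.
apply: le_trans (H _) _; last by lra.
move=> s r /andP[s0 s1] /=.
have -> : C' * (s - r) ^+ 2 = C * (aff s - aff r) ^+ 2 by rewrite /C' /aff; ring.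
by apply: hC; rewrite /= in_itv /= /aff; apply/andP; split; nra.
Qed.

End Weierstrass.

(** * Continuous functional calculus *)

Section FunctionalCalculus.
Context {R : realType} {V : unitalJBAlgType R}.
Implicit Types (a b x y : V) (p q : {poly R}) (f g : R -> R).

(* [x] is f(a): the joint limit of p and p(a) as p approaches f on Sp a. *)
Definition fcalc a f x := forall e : R, 0 < e -> exists2 p : {poly R},
  forall l, Sp a l -> `|f l - p.[l]| <= e & `|x - pa a p| <= e.

Lemma pa_norm_bound a p (e : R) : 0 <= e ->
  (forall l, Sp a l -> `|p.[l]| <= e) -> `|pa a p| <= e.
Proof.
(* In the zero algebra the spectrum is empty, so no point of it attains the norm. *)
move=> e0 h; have [j0|j0] := eqVneq (jone : V) 0.
  by rewrite -(jmul1 (pa a p)) j0 jmul0l normr0.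
by have [l Sl <-] := Sp_norm_attained a p j0; exact: h.
Qed.

Lemma fcalc_pa a p : fcalc a (horner p) (pa a p).
Proof. by move=> e e0; exists p => [l _|]; rewrite subrr normr0 ltW. Qed.

Lemma fcalc_ext a f g x : (forall l, Sp a l -> f l = g l) ->
  fcalc a f x -> fcalc a g x.
Proof.
move=> fg h e /h[p hp hx]; exists p => // l Sl.
by rewrite -fg // hp.
Qed.

Lemma fcalc_norm_le a f x (m : R) : fcalc a f x -> 0 <= m ->
  (forall l, Sp a l -> `|f l| <= m) -> `|x| <= m.
Proof.
move=> h m0 fm; apply: (@eps_le _ _ _ 2) => // e e0 e1.
have [p hp hx] := h _ e0.
have : `|pa a p| <= m + e.
  apply: pa_norm_bound => [|l Sl]; first by rewrite addr_ge0 // ltW.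
  have := ler_distD (f l) (p.[l]) 0; rewrite !subr0 distrC.
  by have := hp _ Sl; have := fm _ Sl; lra.
have := ler_distD (pa a p) x 0; rewrite !subr0; lra.
Qed.

Lemma fcalc_le_norm a f x (l : R) : fcalc a f x -> Sp a l -> `|f l| <= `|x|.
Proof.
move=> h Sl; apply: (@eps_le _ _ _ 2) => // e e0 e1.
have [p hp hx] := h _ e0; have := hp _ Sl; have := Sp_norm_le p Sl.
have := ler_distD (p.[l]) (f l) 0; rewrite !subr0.
have := ler_distD x (pa a p) 0; rewrite !subr0 (distrC _ x); lra.
Qed.

Lemma fcalcD a f g x y : fcalc a f x -> fcalc a g y ->
  fcalc a (fun l => f l + g l) (x + y).
Proof.
move=> hf hg e e0; have e2 : 0 < e / 2 by rewrite divr_gt0.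
have [p hp hx] := hf _ e2; have [q hq hy] := hg _ e2.
exists (p + q) => [l Sl|].
  rewrite hornerD opprD addrACA (le_trans (ler_normD _ _)) //.
  by have := hp _ Sl; have := hq _ Sl; lra.
by rewrite linearD /= opprD addrACA (le_trans (ler_normD _ _)) //; lra.
Qed.

Lemma fcalcZ a (k : R) f x : fcalc a f x -> fcalc a (fun l => k * f l) (k *: x).
Proof.
move=> hf e e0; have k1 : 0 < `|k| + 1 by rewrite ltr_wpDl.
have [p hp hx] := hf _ (divr_gt0 e0 k1).
have le (u : R) : u <= e / (`|k| + 1) -> `|k| * u <= e.
  move=> ue; apply: le_trans (ler_wpM2l (normr_ge0 _) ue) _.
  by rewrite mulrCA ler_piMr ?(ltW e0) // ler_pdivrMr // mul1r lerDl.
exists (k *: p) => [l Sl|]; first by rewrite hornerZ -mulrBr normrM le // hp.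
by rewrite linearZ /= -scalerBr normrZ le.
Qed.

Lemma fcalcM a f g x y : fcalc a f x -> fcalc a g y ->
  fcalc a (fun l => f l * g l) (x ∘ y).
Proof.
move=> hf hg e e0.
have y1 : 0 < 2 * (`|y| + 1) by rewrite mulr_gt0 // ltr_wpDl.
have [p hp hx] := hf _ (divr_gt0 e0 y1).
have p1 : 0 < 2 * (`|pa a p| + 1) by rewrite mulr_gt0 // ltr_wpDl.
have [q hq hy] := hg _ (divr_gt0 e0 p1).
have bnd (u v U : R) : 0 <= u -> 0 <= v -> v <= U -> u <= e / (2 * (U + 1)) ->
    u * v <= e / 2.
  move=> u0 v0 vU; have U1 : 0 < 2 * (U + 1) by lra.
  rewrite ler_pdivlMr // => h; have : u * v <= u * (U + 1) by nra.
  lra.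
exists (p * q) => [l Sl|].
  rewrite hornerM.
  have -> : f l * g l - p.[l] * q.[l] = (f l - p.[l]) * g l + (g l - q.[l]) * p.[l].
    by ring.
  rewrite (le_trans (ler_normD _ _)) // !normrM.
  have := bnd _ _ _ (normr_ge0 _) (normr_ge0 _) (fcalc_le_norm hg Sl) (hp _ Sl).
  have := bnd _ _ _ (normr_ge0 _) (normr_ge0 _) (Sp_norm_le p Sl) (hq _ Sl).
  lra.
rewrite paM.
have -> : x ∘ y - pa a p ∘ pa a q = (x - pa a p) ∘ y + (y - pa a q) ∘ pa a p.
  by rewrite !jmulE (jmulC y) (jmulC (pa a q)); lmod R.
rewrite (le_trans (ler_normD _ _)) //.
have := jb_normM (x - pa a p) y; have := jb_normM (y - pa a q) (pa a p).
have := bnd _ _ _ (normr_ge0 _) (normr_ge0 _) (lexx `|y|) hx.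
have := bnd _ _ _ (normr_ge0 _) (normr_ge0 _) (lexx `|pa a p|) hy.
lra.
Qed.

Lemma fcalc1 a : fcalc a (fun=> 1) jone.
Proof.
apply: (@fcalc_ext _ (horner 1)) => [l _|]; first by rewrite hornerC.
by rewrite -(pa1 a); exact: fcalc_pa.
Qed.

Lemma fcalc_id a : fcalc a id a.
Proof.
apply: (@fcalc_ext _ (horner 'X)) => [l _|]; first by rewrite hornerX.
by rewrite -{2}(paX a); exact: fcalc_pa.
Qed.

Lemma fcalc_uniq a f x y : fcalc a f x -> fcalc a f y -> x = y.
Proof.
move=> hx hy; apply/eqP; rewrite -subr_eq0 -normr_le0.
have := fcalcD hx (fcalcZ (-1) hy); rewrite scaleN1r => h.
by apply: (fcalc_norm_le h) => // l _; rewrite mulN1r subrr normr0.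
Qed.

(** By [pa_norm_bound], the values p(a) of polynomials approaching [f] on the spectrum form a Cauchy
    filter. *)
Lemma fcalc_exists a f : {within Sp a, continuous f} -> exists x, fcalc a f x.
Proof.
move=> fc; pose near_f e := [set p : {poly R} | forall l, Sp a l -> `|f l - p.[l]| <= e].
have W e : 0 < e -> exists p, near_f e p by exact: weierstrass (@Sp_compact _ _ a) fc e.
pose F : set_system V :=
  filter_from [set e : R | 0 < e] (fun e => pa a @` near_f e).
have FF : ProperFilter F.
  apply: filter_from_proper; last first.
    by move=> e /W[p hp]; exists (pa a p), p.
  apply: filter_from_filter; first by exists 1 => /=.
  move=> d e d0 e0; exists (Num.min d e); first by rewrite /= lt_min d0.
  move=> _ [p hp <-]; split; exists p => // l Sl; apply: le_trans (hp _ Sl) _.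
    by rewrite ge_min lexx.
  by rewrite ge_min lexx orbT.
have : cvg F.
  apply: cauchy_cvg; apply: cauchy_exP => e e0.
  have e3 : 0 < e / 3 by rewrite divr_gt0.
  have [p hp] := W _ e3.
  exists (pa a p); exists (e / 3) => // _ [q hq <-].
  rewrite -ball_normE /= -linearB.
  apply: (@le_lt_trans _ _ (2 * (e / 3))); last by lra.
  apply: pa_norm_bound => [|l Sl]; first by lra.
  rewrite hornerD hornerN; have := hp _ Sl; have := hq _ Sl.
  by have := ler_distD (f l) (p.[l]) (q.[l]); rewrite (distrC (p.[l]) (f l)); lra.
move=> /cvg_ex[x Fx]; exists x => e e0.
have [d /= d0 de] := Fx _ (nbhsx_ballx x e e0).
have [|p hp] := W (Num.min d e); first by rewrite lt_min d0.
exists p => [l Sl|].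
  by apply: le_trans (hp _ Sl) _; rewrite ge_min lexx orbT.
have : ball x e (pa a p).
  apply: de; exists p => // l Sl; apply: le_trans (hp _ Sl) _.
  by rewrite ge_min lexx.
by rewrite -ball_normE => /ltW.
Qed.

Lemma fcalc_norm a f x : fcalc a f x -> `|x| = sup [set `|f l| | l in Sp a].
Proof.
move=> h; have ub : ubound [set `|f l| | l in Sp a] `|x|.
  by move=> _ [l Sl <-]; exact: fcalc_le_norm h Sl.
(* The supremum of the empty set is 0 by convention, which agrees with x = 0. *)
have [S0|/set0P[l0 Sl0]] := eqVneq (Sp a) set0.
  rewrite S0 image_set0 sup0; apply/eqP; rewrite normr_eq0 -normr_le0.
  by apply: (fcalc_norm_le h) => // l; rewrite S0.
have hs : has_sup [set `|f l| | l in Sp a].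
  by split; [exists `|f l0|, l0|exists (`|x|)].
apply/eqP; rewrite eq_le; apply/andP; split.
  apply: (fcalc_norm_le h) => [|l Sl].
    apply: le_trans (normr_ge0 (f l0)) _.
    by apply: ub_le_sup; [exists (`|x|)|exists l0].
  by apply: ub_le_sup; [exists (`|x|)|exists l].
by apply: ge_sup => //; exists `|f l0|, l0.
Qed.

Lemma continuous_functional_calculus_exists a :
  continuous_functional_calculus a (fun f => get (fcalc a f)).
Proof.
have getE f x : fcalc a f x -> get (fcalc a f) = x.
  by move=> h; apply: (@fcalc_uniq a f) => //; exact: (getI h).
have getP f : {within Sp a, continuous f} -> fcalc a f (get (fcalc a f)).
  by move=> /fcalc_exists[x h]; rewrite (getE _ _ h).
split.
- by move=> f g /getP hf /getP hg; apply: getE; exact: fcalcD.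
- by move=> k f /getP hf; apply: getE; exact: fcalcZ.
- by move=> f g /getP hf /getP hg; apply: getE; exact: fcalcM.
- by apply: getE; exact: fcalc1.
- by apply: getE; exact: fcalc_id.
- by move=> f /getP /fcalc_norm.
Qed.

(** Uniqueness of the calculus: the algebraic clauses force [phi] on polynomials, and the isometry
    clause with uniform approximation forces it on [f]. *)
Lemma functional_calculus_fcalc a phi f : continuous_functional_calculus a phi ->
  {within Sp a, continuous f} -> fcalc a f (phi f).
Proof.
move=> [phiD phiZ phiM phi1 phi_id phi_norm] fc.
have hc p : {within Sp a, continuous (horner p)}.
  by apply: continuous_subspaceT; exact: continuous_horner.
have c1 : {within Sp a, continuous (fun=> 1 : R)}.
  by apply: continuous_subspaceT; exact: cst_continuous.
have phi_pa p : phi (horner p) = pa a p.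
  elim/poly_ind: p => [|p c IH].
    have -> : horner 0 = (fun l : R => 0 * 1).
      by apply/funext => l; rewrite horner0 mul0r.
    by rewrite phiZ // scale0r linear0.
  have -> : horner (p * 'X + c%:P) = (fun l => p.[l] * l + c * 1).
    by apply/funext => l; rewrite !hornerE.
  have h1 : (fun l => p.[l] * l) = horner (p * 'X).
    by apply/funext => l; rewrite !hornerE.
  have h2 : (fun=> c * 1) = horner c%:P.
    by apply/funext => l; rewrite !hornerE.
  rewrite phiD; [|by rewrite h1|by rewrite h2].
  rewrite phiZ // phi1 phiM //; last by apply: continuous_subspaceT => l; exact: cvg_id.
  by rewrite IH phi_id linearD /= paM paX paC.
move=> e e0; have [p hp] := weierstrass (@Sp_compact _ _ a) fc e0.
exists p => //; rewrite -phi_pa.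
have -> : phi f - phi (horner p) = phi (fun l => f l + (- p).[l]).
  by rewrite phiD // !phi_pa linearN.
rewrite phi_norm; last first.
  by move=> l; apply: continuousD; [exact: fc|exact: hc].
have [S0|/set0P[l0 Sl0]] := eqVneq (Sp a) set0.
  by rewrite S0 image_set0 sup0 ltW.
apply: ge_sup; first by exists `|f l0 + (- p).[l0]|, l0.
by move=> _ [l Sl <-]; rewrite hornerN; exact: hp.
Qed.

Lemma fcalc_cfc a f : {within Sp a, continuous f} -> fcalc a f (cfc a f).
Proof.
move=> fc; rewrite /cfc; set P := (X in get X).
have : P (get P).
  by apply: getI; exists (fun f => get (fcalc a f)) => //;
    exact: continuous_functional_calculus_exists.
by move=> [phi hphi <-]; exact: functional_calculus_fcalc.
Qed.

End FunctionalCalculus.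

(** * Positivity of the quadratic operators *)

Section PositivityOfU.
Context {R : realType} {V : unitalJBAlgType R}.
Implicit Types (a b c h s x y : V) (p q : {poly R}) (f g : R -> R).

Lemma pa_linear a (t : R) : pa a (t%:P - 'X) = t *: jone - a.
Proof. by rewrite linearB /= paC paX. Qed.

(** Both directions compare the norm of t + m - a with the values t + m - l on the spectrum. *)
Lemma npos_ge a (m : R) : npos (a - m *: jone) <-> (forall l, Sp a l -> m <= l).
Proof.
split=> [[t]|h].
  have -> : t *: jone - (a - m *: jone) = (t + m) *: jone - a by lmod R.
  rewrite -pa_linear => le l Sl; have := Sp_norm_le ((t + m)%:P - 'X) Sl.
  rewrite !hornerE ler_norml => /andP[_]; lra.
exists (`|a| + `|m|).
have -> : (`|a| + `|m|) *: jone - (a - m *: jone) = (`|a| + `|m| + m) *: jone - a.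
  by lmod R.
rewrite -pa_linear; apply: pa_norm_bound => [|l Sl]; first by rewrite addr_ge0.
rewrite !hornerE ler_norml; have := h _ Sl; have := Sp_le_norm Sl.
rewrite ler_norml => /andP[h1 h2] h3.
have := ler_norm (- m); rewrite normrN => h4; lra.
Qed.

Lemma jpositiveP a : jpositive a <-> npos a.
Proof.
have := npos_ge a 0; rewrite scale0r subr0 => ->; split=> h l; exact: h.
Qed.

(** 0 lies outside the closed spectrum, so a whole interval around it does. *)
Lemma Sp_ge_of_pos_inv a : jpositive a -> jinvertible a ->
  exists2 m : R, 0 < m & forall l, Sp a l -> m <= l.
Proof.
move=> pa ia.
have /closed_openC := @Sp_closed _ _ a; rewrite openE => /(_ 0)[].
  by move=> /=; apply; rewrite scale0r subr0.
move=> d /= d0 dS; exists d => // l Sl; rewrite leNgt; apply/negP => ld.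
have l0 : 0 <= l by exact: (pa l Sl).
apply: (dS l _ Sl); rewrite /= sub0r normrN ger0_norm //.
Qed.

Lemma npos_sub_sqr b : npos b -> `|b| <= 1 -> npos (b - b ∘ b).
Proof.
move=> pb b1; have hC := Ca_subalg b.
have p1 : npos (jone - b) by have := npos_norm1B b1; rewrite scale1r.
have := npos_mul hC (Ca_closed b) (Ca_id b)
  (asubB hC (asub1 hC) (Ca_id b)) pb p1.
by rewrite jmulBr jmulr1.
Qed.

(* (b + c)^2 >= 0 and b >= b^2 *)
Lemma npos_add_mul1 b c : npos b -> `|b| <= 1 ->
  npos (b + 2 *: (c ∘ b) + `|c| ^+ 2 *: jone).
Proof.
move=> pb b1.
have -> : b + 2 *: (c ∘ b) + `|c| ^+ 2 *: jone =
  (b - b ∘ b) + (b + c) ∘ (b + c) + (`|c| ^+ 2 *: jone - c ∘ c).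
  by rewrite !jmulE (jmulC b c); lmod R.
apply: nposD; last by apply: npos_norm1B; rewrite jb_norm_sqr.
by apply: nposD; [exact: npos_sub_sqr|exact: npos_sqr].
Qed.

Lemma npos_add_mul b c (M : R) : npos b -> `|b| <= M -> 0 < M ->
  npos (b + 2 *: (c ∘ b) + (M * `|c| ^+ 2) *: jone).
Proof.
move=> pb bM M0; have M0' : 0 <= M := ltW M0; have Mn0 : M != 0 by rewrite gt_eqF.
have : npos (M^-1 *: b) by apply: nposZ => //; rewrite invr_ge0.
move=> /(@npos_add_mul1 _ c) h; have {}h := nposZ M0' (h _).
have -> : b + 2 *: (c ∘ b) + (M * `|c| ^+ 2) *: jone = M *:
  (M^-1 *: b + 2 *: (c ∘ (M^-1 *: b)) + `|c| ^+ 2 *: jone).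
  by rewrite !jmulE; lmod R.
by apply: h; rewrite normrZ gtr0_norm ?invr_gt0 // ler_pdivrMl // mulr1.
Qed.

Lemma jU_norm a b : `|jU a b| <= 3 * `|a| ^+ 2 * `|b|.
Proof.
rewrite jUE; apply: (le_trans (ler_normB _ _)); rewrite normrZ gtr0_norm //.
have h1 := jb_normM a (a ∘ b); have h2 := jb_normM a b.
have h3 := jb_normM (a ∘ a) b; rewrite jb_norm_sqr in h3.
have h4 : `|a| * `|a ∘ b| <= `|a| * (`|a| * `|b|) by rewrite ler_wpM2l.
by rewrite expr2 in h3 *; lra.
Qed.

Lemma jU_1D h b : jU (jone + h) b = b + 2 *: (h ∘ b) + jU h b.
Proof. by rewrite !jUE !jmulE !jmul1 !jmulr1; lmod R. Qed.

Lemma nposD_scal1 x (d d' : R) : npos (x + d *: jone) -> d <= d' ->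
  npos (x + d' *: jone).
Proof.
move=> px dd; have -> : x + d' *: jone = (x + d *: jone) + (d' - d) *: jone.
  by lmod R.
by apply: nposD => //; apply: npos_scal1; rewrite subr_ge0.
Qed.

(** * Quadratic operators of elements near the unit *)

Section NearIdentity.
Variables (h : V) (eta : R).
Hypotheses (h_eta : `|h| <= eta) (eta1 : eta <= 1).
Let s := jone + h.
Let eta0 : 0 <= eta := le_trans (normr_ge0 h) h_eta.
Let h2 : `|h| ^+ 2 <= eta ^+ 2.
Proof. by rewrite lerXn2r // nnegrE. Qed.
Let eta2 : eta ^+ 2 <= eta.
Proof. by rewrite expr2 ler_piMr. Qed.
Let eta20 : 0 <= eta ^+ 2. Proof. exact: sqr_ge0. Qed.

(** In U_(1+h) b = (b + 2 h b) + U_h b the bracket costs M eta^2 and the last term has norm at most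
    3 eta^2 M. *)
Lemma jU_near1_pos b (M : R) : npos b -> `|b| <= M -> 0 < M ->
  npos (jU s b + (4 * eta ^+ 2 * M) *: jone).
Proof.
move=> pb bM M0; rewrite /s jU_1D.
have -> : b + 2 *: (h ∘ b) + jU h b + (4 * eta ^+ 2 * M) *: jone =
    (b + 2 *: (h ∘ b) + (M * eta ^+ 2) *: jone) +
    ((3 * eta ^+ 2 * M) *: jone - (- jU h b)).
  by lmod R.
apply: nposD.
  by apply: nposD_scal1 (npos_add_mul _ pb bM M0) _; rewrite ler_pM2l.
apply: npos_norm1B; rewrite normrN; apply: (le_trans (jU_norm h b)).
by rewrite ler_pM ?mulr_ge0 // ?sqr_ge0 // ler_pM2l.
Qed.

Lemma jU_near1_norm x : `|jU s x| <= (1 + 5 * eta) * `|x|.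
Proof.
rewrite /s jU_1D; have := jU_norm h x; have := jb_normM h x.
have x0 := normr_ge0 x.
have : `|h| * `|x| <= eta * `|x| by rewrite ler_wpM2r.
have : `|h| ^+ 2 * `|x| <= eta * `|x| by rewrite ler_wpM2r // (le_trans h2).
have := ler_normD (x + 2 *: (h ∘ x)) (jU h x); have := ler_normD x (2 *: (h ∘ x)).
rewrite normrZ gtr0_norm // -mulrA; lra.
Qed.

Lemma norm_near1_sqr : `|s ∘ s| <= (1 + eta) ^+ 2.
Proof.
rewrite jb_norm_sqr lerXn2r // ?nnegrE ?addr_ge0 //.
by rewrite (le_trans (ler_normD _ _)) // lerD // norm_jone_le1.
Qed.

(** If x + d >= 0 and ‖x‖ <= E, one step gives U_s x + d s^2 + 4 eta^2 (E + d) >= 0, where s^2 <= (1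
    + eta)^2. As eta <= 1, the new error is at most (1 + 7 eta) d + 4 eta^2 E. *)
Lemma jU_near1_iter b (M : R) k : npos b -> `|b| <= M -> 0 < M ->
  `|iter k (jU s) b| <= (1 + 5 * eta) ^+ k * M /\
  npos (iter k (jU s) b +
        (k%:R * (4 * eta ^+ 2) * (1 + 7 * eta) ^+ k * M) *: jone).
Proof.
move=> pb bM M0; elim: k => [|k [IH1 IH2]].
  by rewrite expr0 !mul1r !mul0r scale0r addr0.
have eta0' := eta0.
have e5 : 1 <= 1 + 5 * eta by lra.
have e7 : 1 <= 1 + 7 * eta by lra.
set x := iter k (jU s) b in IH1 IH2 *.
split.
  rewrite iterS -/x (le_trans (jU_near1_norm x)) // exprS -mulrA ler_wpM2l //; lra.
set d := _ * M in IH2.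
have d0 : 0 <= d.
  by rewrite /d !mulr_ge0 ?exprn_ge0 //; lra.
set E := (1 + 5 * eta) ^+ k * M in IH1.
have E0 : 0 < E by rewrite /E mulr_gt0 // exprn_gt0; lra.
have xd : `|x + d *: jone| <= E + d.
  by rewrite (le_trans (ler_normD _ _)) // lerD // normZ_jone.
have h1 := jU_near1_pos IH2 xd (ltr_wpDr d0 E0).
rewrite jUDl jUZ jU1r in h1.
have h3 : npos (((1 + eta) ^+ 2 * d) *: jone - d *: (s ∘ s)).
  apply: npos_norm1B; rewrite normrZ ger0_norm // mulrC ler_wpM2r //.
  exact: norm_near1_sqr.
rewrite iterS -/x.
have := nposD h1 h3.
have -> : jU s x + d *: (s ∘ s) + (4 * eta ^+ 2 * (E + d)) *: jone +
   (((1 + eta) ^+ 2 * d) *: jone - d *: (s ∘ s)) =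
   jU s x + (4 * eta ^+ 2 * (E + d) + (1 + eta) ^+ 2 * d) *: jone by lmod R.
move=> /nposD_scal1; apply.
have E7 : E <= (1 + 7 * eta) ^+ k.+1 * M.
  rewrite ler_pM2r // (@le_trans _ _ ((1 + 7 * eta) ^+ k)) //.
    by rewrite lerXn2r // ?nnegrE; lra.
  by rewrite ler_weXn2l.
have -> : k.+1%:R * (4 * eta ^+ 2) * (1 + 7 * eta) ^+ k.+1 * M =
    (1 + 7 * eta) * d + 4 * eta ^+ 2 * ((1 + 7 * eta) ^+ k.+1 * M).
  by rewrite /d -[k.+1%:R]natr1 !exprS; ring.
have : 4 * eta ^+ 2 * E <= 4 * eta ^+ 2 * ((1 + 7 * eta) ^+ k.+1 * M).
  by rewrite ler_wpM2l // mulr_ge0.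
have : eta ^+ 2 * d <= eta * d by rewrite ler_wpM2r.
lra.
Qed.

End NearIdentity.

Lemma jU_iter s n b : iter n (jU s) b = jU (jpown s n) b.
Proof.
elim: n => [|n IH]; first by rewrite jU1l.
rewrite iterS IH (jU_mul _ (Ca_subalg s)) //; first exact: Ca_id.
by rewrite -paXn; exact: Ca_pa.
Qed.

(* [U_a = U_s ^ n] with s = a^(1/n), and each factor fails to be positive
   only to order 1/n^2. *)
Lemma jU_pos a b (K : R) : 0 <= K ->
  (forall n, (0 < n)%N -> exists2 s, jpown s n = a & `|s - jone| <= K / n%:R) ->
  npos b -> npos (jU a b).
Proof.
move=> K0 roots pb; apply: npos_closed => e e0.
pose M := `|b| + 1; have M0 : 0 < M by rewrite ltr_wpDl.
have bM : `|b| <= M by rewrite lerDl.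
(* Since (1 + 7 K / n)^n <= exp(7 K), the accumulated error is at most [Z] / n. *)
pose Z := 4 * K ^+ 2 * expR (7 * K) * M.
have Z0 : 0 <= Z.
  by rewrite /Z !mulr_ge0 ?sqr_ge0 ?expR_ge0 // ltW.
pose n := maxn (Num.truncn K).+1 (Num.truncn (Z / e)).+1.
have n0 : (0 < n)%N by rewrite /n leq_max.
have nr0 : 0 < (n%:R : R) by rewrite ltr0n.
have Kn : K <= n%:R.
  by rewrite (le_trans (ltW (Num.Theory.truncnS_gt K))) // ler_nat leq_maxl.
have Zn : Z / n%:R <= e.
  rewrite ler_pdivrMr // mulrC -ler_pdivrMr //.
  by rewrite (le_trans (ltW (Num.Theory.truncnS_gt _))) // ler_nat leq_maxr.
have [s sa sK] := roots n n0.
have K1 : K / n%:R <= 1 by rewrite ler_pdivrMr // mul1r.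
have := (jU_near1_iter sK K1 n pb bM M0).2.
rewrite [jone + _]addrC subrK jU_iter sa; set d := (X in X *: jone) => h.
have d_ge0 : 0 <= d.
  rewrite /d !mulr_ge0 ?sqr_ge0 ?exprn_ge0 ?(ltW M0) //.
  by rewrite addr_ge0 // mulr_ge0 // divr_ge0 // ltW.
exists (jU a b + d *: jone) => //.
rewrite opprD addNKr normrN (le_trans (normZ_jone d_ge0)) //.
apply: le_trans Zn.
have -> : d = 4 * K ^+ 2 * (1 + 7 * (K / n%:R)) ^+ n * M / n%:R.
  by rewrite /d; field; rewrite gt_eqF.
rewrite ler_pM2r ?invr_gt0 // /Z ler_pM2r // ler_wpM2l ?mulr_ge0 ?sqr_ge0 //.
have -> : expR (7 * K) = expR (7 * (K / n%:R)) ^+ n.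
  by rewrite -expRM_natl; congr expR; field; rewrite gt_eqF.
rewrite lerXn2r // ?nnegrE ?expR_ge0 ?expR_ge1Dx //.
by rewrite addr_ge0 // mulr_ge0 // divr_ge0 // ltW.
Qed.

End PositivityOfU.

(** * Heinz and Heron means *)

Section ScalarInequalities.
Context {R : realType}.
Implicit Types (x t u w be nu r : R).

Lemma norm_expR_sub1 u : `|expR u - 1| <= `|u| * expR `|u|.
Proof.
have h1 := expR_ge1Dx u; have h2 := expR_ge1Dx (- u).
have e0 := expR_gt0 u; have e1 : expR u * expR (- u) = 1.
  by rewrite -expRD subrr expR0.
have [u0|u0] := leP 0 u.
  rewrite !ger0_norm //; last by rewrite subr_ge0 -[leLHS]addr0; lra.
  have : expR u * (1 - u) <= expR u * expR (- u) by rewrite ler_pM2l //; lra.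
  lra.
rewrite !ltr0_norm //; last by rewrite subr_lt0 expR_lt1.
have : 1 <= expR (- u) by lra.
nra.
Qed.

Definition twice_sinh w := expR w - expR (- w).

Lemma twice_sinhN w : twice_sinh (- w) = - twice_sinh w.
Proof. by rewrite /twice_sinh opprK opprB. Qed.

Lemma is_derive_expR_scale (k x : R) :
  is_derive x 1 (fun t => expR (k * t)) (k * expR (k * x)).
Proof.
have h : is_derive x 1 (fun t : R => k * t) k.
  have := @is_deriveZ _ _ _ (@id R) k x 1 1 _.
  by rewrite /GRing.scale /= mulr1; apply; exact: is_derive_id.
have := @is_derive1_comp _ expR (fun t => k * t) x _ _ (is_derive_expR _) h.
by rewrite mulrC.
Qed.

(** The difference vanishes at 0 and has derivative 2 be (cosh t - cosh(be t)) >= 0. *)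
Lemma twice_sinh_le be w : 0 <= be <= 1 -> 0 <= w ->
  twice_sinh (be * w) <= be * twice_sinh w.
Proof.
move=> /andP[be0 be1] w0.
(* The factors 1 and -1 are kept so that one derivative rule covers all four exponentials. *)
pose f t := be *: (expR (1 * t) - expR (-1 * t)) -
            (expR (be * t) - expR ((- be) * t)).
pose df t := be *: (1 * expR (1 * t) - -1 * expR (-1 * t)) -
            (be * expR (be * t) - (- be) * expR ((- be) * t)).
have fdf t : is_derive t 1 f (df t).
  have e k := is_derive_expR_scale k t.
  exact: is_deriveB.
have fc : {within `[0, w], continuous f}.
  apply: continuous_subspaceT => t; apply: differentiable_continuous.
  by apply/derivable1_diffP; have [] := fdf t.
have [c + cE] := MVT_segment w0 (fun t _ => fdf t) fc.
rewrite in_itv /= => /andP[c0 cw].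
have f0 : f 0 = 0 by rewrite /f !mulr0 !subrr scaler0 subr0.
have fw : f w = be * twice_sinh w - twice_sinh (be * w).
  by rewrite /f /twice_sinh mul1r !mulNr mul1r.
suff dc : 0 <= df c.
  by rewrite -subr_ge0 -fw; move: cE; rewrite f0 !subr0 => ->; exact: mulr_ge0.
have -> : df c = be * (expR c + expR (- c) - (expR (be * c) + expR (- (be * c)))).
  by rewrite /df /GRing.scale /= !mulNr !mul1r; ring.
rewrite mulr_ge0 //; set v := be * c.
have v0 : 0 <= v by rewrite mulr_ge0.
have vc : v <= c by rewrite ler_piMl.
have -> : expR c + expR (- c) - (expR v + expR (- v)) =
    (expR c - expR v) * (1 - expR (- c - v)).
  have E1 : expR c * expR (- c - v) = expR (- v) by rewrite -expRD; congr expR; ring.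
  have E2 : expR v * expR (- c - v) = expR (- c) by rewrite -expRD; congr expR; ring.
  by rewrite mulrBr mulr1 mulrBl E1 E2; ring.
rewrite mulr_ge0 // subr_ge0 ?ler_expR // expR_le1; lra.
Qed.

Lemma twice_sinh_norm_sqr be t :
  twice_sinh (`|be| * `|t|) ^+ 2 = twice_sinh (be * t) ^+ 2.
Proof.
by rewrite -normrM; case: (ger0P (be * t)) => _ //; rewrite twice_sinhN sqrrN.
Qed.

Lemma twice_sinh_sqr_le be t : be ^+ 2 <= 1 ->
  twice_sinh (be * t) ^+ 2 <= be ^+ 2 * twice_sinh t ^+ 2.
Proof.
have := twice_sinh_norm_sqr 1 t; rewrite normr1 !mul1r => <- be1.
rewrite -twice_sinh_norm_sqr -[be ^+ 2]real_normK ?num_real // -exprMn.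
have nbe : 0 <= `|be| <= 1.
  by rewrite normr_ge0 /= -(@expr_le1 _ 2) // real_normK ?num_real.
have s0 u : 0 <= u -> 0 <= twice_sinh u.
  by move=> u0; rewrite subr_ge0 ler_expR; lra.
rewrite lerXn2r // ?nnegrE ?s0 ?mulr_ge0 ?s0 //.
exact: twice_sinh_le.
Qed.

(** The previous inequality with 1 / be and be t in place of be and t. *)
Lemma twice_sinh_sqr_ge be t : 1 <= be ^+ 2 ->
  be ^+ 2 * twice_sinh t ^+ 2 <= twice_sinh (be * t) ^+ 2.
Proof.
move=> be1; have be2 : 0 < be ^+ 2 by lra.
have be0 : be != 0 by rewrite -sqrf_eq0 gt_eqF.
have := @twice_sinh_sqr_le be^-1 (be * t).
rewrite mulKf // exprVn invf_le1 // => /(_ be1).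
by rewrite ler_pdivlMl.
Qed.

Definition heron_heinz_gap nu x :=
  (1 - (1 - 2 * nu) ^+ 2) * x `^ 2^-1 + (1 - 2 * nu) ^+ 2 * (2^-1 * (1 + x))
  - 2^-1 * (x `^ nu + x `^ (1 - nu)).

(* x = exp(4t), and cosh(2z) - 1 = 2 sinh(z)^2 *)
Lemma heron_heinz_gapE nu t : let be := 1 - 2 * nu in
  heron_heinz_gap nu (expR (4 * t)) = expR (2 * t) / 2 *
    (be ^+ 2 * twice_sinh t ^+ 2 - twice_sinh (be * t) ^+ 2).
Proof.
move=> be; rewrite /heron_heinz_gap -/be -!expRM /twice_sinh !expRN.
have -> : expR (4 * t) = expR t ^+ 4 by rewrite -expRM_natl.
have -> : expR (2 * t) = expR t ^+ 2 by rewrite -expRM_natl.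
have -> : expR (4 * t * 2^-1) = expR t ^+ 2.
  by rewrite -expRM_natl; congr expR; field.
have -> : expR (4 * t * nu) = expR t ^+ 2 / expR (be * t) ^+ 2.
  by rewrite -!expRM_natl -expRB; congr expR; rewrite /be; ring.
have -> : expR (4 * t * (1 - nu)) = expR t ^+ 2 * expR (be * t) ^+ 2.
  by rewrite -!expRM_natl -expRD; congr expR; rewrite /be; ring.
by field; rewrite !gt_eqF ?expR_gt0.
Qed.

Lemma heron_heinz_gap_ge0 nu x : 0 < x -> (1 - 2 * nu) ^+ 2 <= 1 ->
  0 <= heron_heinz_gap nu x.
Proof.
move=> x0 be1; have -> : x = expR (4 * (ln x / 4)).
  by rewrite mulrC divfK // lnK.
rewrite heron_heinz_gapE mulr_ge0 ?divr_ge0 ?expR_ge0 // subr_ge0.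
exact: twice_sinh_sqr_le.
Qed.

Lemma heron_heinz_gap_le0 nu x : 0 < x -> 1 <= (1 - 2 * nu) ^+ 2 ->
  heron_heinz_gap nu x <= 0.
Proof.
move=> x0 be1; have -> : x = expR (4 * (ln x / 4)).
  by rewrite mulrC divfK // lnK.
rewrite heron_heinz_gapE mulr_ge0_le0 ?divr_ge0 ?expR_ge0 // subr_le0.
exact: twice_sinh_sqr_ge.
Qed.

Lemma continuous_powR r x : 0 < x -> {for x, continuous (fun y : R => y `^ r)}.
Proof.
move=> x0; apply: differentiable_continuous; apply/derivable1_diffP.
by apply: derivable_powR; rewrite in_itv /= x0.
Qed.

(** From x^r = exp(r ln x). For exponents r / n the bound is of order 1/n, as [jU_pos] demands of
    the roots. *)
Lemma norm_powR_sub1 (m M r : R) x : 0 < m -> m <= x <= M ->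
  `|x `^ r - 1| <= `|r| * (`|ln m| + `|ln M|) * expR (`|r| * (`|ln m| + `|ln M|)).
Proof.
move=> m0 /andP[mx xM]; have x0 : 0 < x by exact: lt_le_trans mx.
have M0 : 0 < M by exact: lt_le_trans xM.
have lx : `|ln x| <= `|ln m| + `|ln M|.
  have h1 : ln m <= ln x by rewrite ler_ln.
  have h2 : ln x <= ln M by rewrite ler_ln.
  have := ler_norm (ln M); have := ler_norm (- ln m); rewrite normrN => h3 h4.
  have := normr_ge0 (ln m); have := normr_ge0 (ln M).
  by rewrite ler_norml; lra.
have -> : x `^ r = expR (r * ln x) by rewrite /powR gt_eqF.
apply: (le_trans (norm_expR_sub1 _)); rewrite normrM.
have le : `|r| * `|ln x| <= `|r| * (`|ln m| + `|ln M|) by rewrite ler_wpM2l.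
by rewrite ler_pM ?mulr_ge0 ?expR_ge0 // ler_expR.
Qed.

End ScalarInequalities.

(** * Real powers and the operator form of the comparison *)

Section Powers.
Context {R : realType} {V : unitalJBAlgType R}.
Implicit Types (a b x : V) (f : R -> R) (r s l : R).

Lemma fcalc_Ca a f x : fcalc a f x -> Ca a x.
Proof. by move=> h; apply/CaP => e /h[p _ hp]; exists p. Qed.

(** On the spectrum 0 <= f <= ‖x‖, so ‖x‖ - f stays within ‖x‖. *)
Lemma fcalc_pos a f x : fcalc a f x -> (forall l, Sp a l -> 0 <= f l) -> npos x.
Proof.
move=> h f0; exists `|x|.
have := fcalcD (fcalcZ `|x| (fcalc1 a)) (fcalcZ (-1) h); rewrite scaleN1r => H.
apply: (fcalc_norm_le H) => // l Sl.
have := fcalc_le_norm h Sl; rewrite (ger0_norm (f0 _ Sl)) mulr1 mulN1r => fx.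
by rewrite ger0_norm ?subr_ge0 // gerBl f0.
Qed.

Section PositiveInvertible.
Variables (a : V) (m : R).
Hypotheses (m0 : 0 < m) (am : forall l, Sp a l -> m <= l).

Let Sp_gt0 l : Sp a l -> 0 < l.
Proof. by move=> /am; exact: lt_le_trans. Qed.

Lemma fcalc_jpow r : fcalc a (fun l => l `^ r) (jpow a r).
Proof.
apply: fcalc_cfc; apply: continuous_in_subspaceT => l; rewrite inE => Sl.
by apply: continuous_powR; exact: Sp_gt0.
Qed.

Lemma jpow_eq f x r : fcalc a f x -> (forall l, Sp a l -> f l = l `^ r) ->
  jpow a r = x.
Proof.
by move=> h fE; apply: (fcalc_uniq (fcalc_jpow r)); exact: fcalc_ext h.
Qed.

Lemma jpowD r s : jpow a r ∘ jpow a s = jpow a (r + s).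
Proof.
symmetry; apply: jpow_eq (fcalcM (fcalc_jpow r) (fcalc_jpow s)) _ => l Sl.
by rewrite powRD // (gt_eqF (Sp_gt0 Sl)) implybT.
Qed.

Lemma jpow0 : jpow a 0 = jone.
Proof. by apply: jpow_eq (fcalc1 a) _ => l _; rewrite powRr0. Qed.

Lemma jpow1 : jpow a 1 = a.
Proof. by apply: jpow_eq (fcalc_id a) _ => l /Sp_gt0/ltW h; rewrite powRr1. Qed.

Lemma jpown_jpow r n : jpown (jpow a r) n = jpow a (n%:R * r).
Proof.
elim: n => [|n IH]; first by rewrite mul0r jpow0.
by rewrite /jpown iterS -/(jpown _ n) IH jpowD -[n.+1%:R]natr1; congr jpow; ring.
Qed.

Lemma jU_jpow r s b : jU (jpow a r) (jU (jpow a s) b) = jU (jpow a (r + s)) b.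
Proof.
rewrite (jU_mul _ (Ca_subalg a) (fcalc_Ca (fcalc_jpow r)) (fcalc_Ca (fcalc_jpow s))).
by rewrite jpowD.
Qed.

Lemma jU_jpow_pos r b : npos b -> npos (jU (jpow a r) b).
Proof.
pose L := `|ln m| + `|ln `|a| |.
have L0 : 0 <= L by rewrite addr_ge0.
apply: (@jU_pos _ _ _ _ (`|r| * L * expR (`|r| * L))).
  by rewrite !mulr_ge0 ?expR_ge0.
move=> n n0; have nr0 : 0 < (n%:R : R) by rewrite ltr0n.
exists (jpow a (r / n%:R)).
  by rewrite jpown_jpow mulrC divfK // gt_eqF.
have := fcalcD (fcalc_jpow (r / n%:R)) (fcalcZ (-1) (fcalc1 a)).
rewrite scaleN1r => h; apply: (fcalc_norm_le h) => [|l Sl].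
  by rewrite divr_ge0 ?ler0n // !mulr_ge0 ?expR_ge0.
have lM : m <= l <= `|a|.
  by rewrite am //= (le_trans (ler_norm l)) // Sp_le_norm.
rewrite mulr1; apply: (le_trans (norm_powR_sub1 _ m0 lM)); rewrite -/L.
have -> : `|r / n%:R| = `|r| / n%:R by rewrite normrM normfV (ger0_norm (ltW nr0)).
rewrite [_ / _ * L]mulrAC; set q := `|r| * L.
have q0 : 0 <= q by rewrite mulr_ge0.
(* Bounding exp(q / n) by exp(q) makes the constant independent of n. *)
rewrite mulrAC ler_pM2r ?invr_gt0 // ler_wpM2l // ler_expR ler_pdivrMr //.
by rewrite ler_peMr // ler1n.
Qed.

End PositiveInvertible.

(** Applying U to b >= d gives at least d a^(-1), and a^(-1) >= 1 / (‖a‖ + m), where adding m keeps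
    the denominator positive. *)
Lemma jU_invsqrt_ge (a b : V) (m d : R) : 0 < m -> (forall l, Sp a l -> m <= l) ->
  0 < d -> (forall l, Sp b l -> d <= l) ->
  exists2 k : R, 0 < k & forall l, Sp (jU (jpow a (- 2^-1)) b) l -> k <= l.
Proof.
move=> m0 am d0 /npos_ge bd; pose k := (`|a| + m)^-1.
have am0 : 0 < `|a| + m by rewrite ltr_wpDl.
have rE : - 2^-1 + - 2^-1 = -1 :> R by lra.
have ak : npos (jpow a (-1) - k *: jone).
  have := fcalcD (fcalc_jpow m0 am (-1)) (fcalcZ (- k) (fcalc1 a)).
  rewrite scaleNr => h; apply: (fcalc_pos h) => l Sl.
  have l0 : 0 < l by exact: lt_le_trans (am _ Sl).
  rewrite mulr1 subr_ge0 powR_inv1 ?(ltW l0) // lef_pV2 ?posrE //.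
  by rewrite (le_trans (ler_norm l)) // (le_trans (Sp_le_norm Sl)) // lerDl ltW.
exists (d * k); first by rewrite mulr_gt0 // invr_gt0.
apply/npos_ge.
have := jU_jpow_pos m0 am (- 2^-1) bd.
rewrite jUB jUZ jU1r (jpowD m0 am) rE => h.
by have := nposD h (nposZ (ltW d0) ak); rewrite scalerBr scalerA addrA subrK.
Qed.

Lemma heron_sub_heinz (a b : V) (m d : R) (nu : R) :
  let c := jU (jpow a (- 2^-1)) b in
  0 < m -> (forall l, Sp a l -> m <= l) -> 0 < d -> (forall l, Sp c l -> d <= l) ->
  exists2 x, fcalc c (heron_heinz_gap nu) x &
    heron ((1 - 2 * nu) ^+ 2) a b - heinz nu a b = jU (jpow a 2^-1) x.
Proof.
move=> c m0 am d0 cd; set al := (1 - 2 * nu) ^+ 2.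
have P r := fcalc_jpow d0 cd r.
exists ((1 - al) *: jpow c 2^-1 + al *: (2^-1 *: (jone + c)) +
    -1 *: (2^-1 *: (jpow c nu + jpow c (1 - nu)))).
  have := fcalcD (fcalcD (fcalcZ (1 - al) (P 2^-1))
      (fcalcZ al (fcalcZ 2^-1 (fcalcD (fcalc1 c) (fcalc_id c)))))
    (fcalcZ (-1) (fcalcZ 2^-1 (fcalcD (P nu) (P (1 - nu))))).
  by apply: fcalc_ext => l _; rewrite /heron_heinz_gap mulN1r.
have aE : jU (jpow a 2^-1) jone = a.
  rewrite jU1r (jpowD m0 am) -{2}(jpow1 m0 am); congr jpow; lra.
have bE : jU (jpow a 2^-1) c = b.
  by rewrite /c (jU_jpow m0 am) subrr (jpow0 m0 am) jU1l.
rewrite /heron /heinz /nabla /sharp -/c; clearbody c.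
rewrite !(jUDl, jUZ) aE bE.
by lmod R.
Qed.

End Powers.

Theorem theorem3p1 (R : realType) (V : unitalJBAlgType R) (A B : V)
  (A_pos : jpositive A) (A_inv : jinvertible A)
  (B_pos : jpositive B) (B_inv : jinvertible B) :
  let alpha (nu : R) : R := (1 - 2 * nu) ^+ 2 in
  (forall nu : R, nu \in `[0, 1] ->
     jle (heinz nu A B) (heron (alpha nu) A B)) /\
  (forall nu : R, nu \notin `]0, 1[ ->
     jle (heron (alpha nu) A B) (heinz nu A B)).
Proof.
move=> alpha.
have [m m0 Am] := Sp_ge_of_pos_inv A_pos A_inv.
have [d d0 Bd] := Sp_ge_of_pos_inv B_pos B_inv.
have [k k0 Ck] := jU_invsqrt_ge m0 Am d0 Bd.
have gap nu := heron_sub_heinz nu m0 Am k0 Ck.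
split=> nu hnu; rewrite /jle; apply/jpositiveP; have [x hx E] := gap nu.
- rewrite /alpha E; apply: jU_jpow_pos m0 Am _ _ _; apply: fcalc_pos hx _ => l Cl.
  apply: heron_heinz_gap_ge0; first exact: lt_le_trans (Ck _ Cl).
  by move: hnu; rewrite in_itv /= => /andP[]; nra.
- rewrite /alpha -opprB E -jUN; apply: jU_jpow_pos m0 Am _ _ _.
  have := fcalcZ (-1) hx; rewrite scaleN1r => h; apply: fcalc_pos h _ => l Cl.
  rewrite mulN1r oppr_ge0.
  apply: heron_heinz_gap_le0; first exact: lt_le_trans (Ck _ Cl).
  by move: hnu; rewrite in_itv /= negb_and -!leNgt => /orP[]; nra.
Qed.
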